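(* Let $N$ be a positive integer and let $A,B\subset\{0,1,2,\dots\}$ be such that $(A,B)$ is a complementary pair for $N$. Let $\mu$ be the Lebesgue measure restricted to the set $A+[0,1]\subset\mathbb{R}$, and let $\nu$ be a finite (positive, nonzero) Borel measure on $\mathbb{R}^m$. If $\mu\times\nu$ is a spectral measure on $\mathbb{R}^{1+m}$, then $\nu$ is a spectral measure on $\mathbb{R}^m$.
   Context: $(A,B)$ is a complementary pair for $N$ if $A\oplus B=\{0,1,\dots,N-1\}$ under addition of integers, i.e. $A+B=\{0,1,\dots,N-1\}$ and every integer in $\{0,1,\dots,N-1\}$ can be written uniquely as $a+b$ with $a\in A$, $b\in B$. For $\lambda\in\mathbb{R}^d$ write $e_\lambda(x)=e^{2\pi i\langle\lambda,x\rangle}$. A finite positive Borel measure $\tau$ on $\mathbb{R}^d$ is a spectral measure if there is a countable set $\Lambda\subset\mathbb{R}^d$, called a spectrum of $\tau$, such that $\{e_\lambda:\lambda\in\Lambda\}$ is an orthogonal basis of $L^2(\tau)$. *)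

(* Defs.v *)
From HB Require Import structures.
From mathcomp Require Import all_boot all_order all_algebra.
From mathcomp Require Import all_classical all_reals all_analysis.
From mathcomp Require Import complex.

Set Implicit Arguments.
Unset Strict Implicit.
Unset Printing Implicit Defensive.

Import Order.TTheory GRing.Theory Num.Theory.
Import ComplexField.Normc.

Local Open Scope classical_set_scope.
Local Open Scope ring_scope.

Definition complementary_pair (N : nat) (A B : set nat) : Prop :=
  [set (a + b)%N | a in A & b in B] = `I_N /\
  forall n, (n < N)%N ->
    exists! p : nat * nat, [/\ A p.1, B p.2 & (p.1 + p.2)%N = n].

Section ComplexL2.
Context d (T : measurableType d) (R : realType).
Variable tau : {measure set T -> \bar R}.

Definition cmeasurable (f : T -> R[i]) : Prop :=
  measurable_fun [set: T] (fun x => complex.Re (f x)) /\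
  measurable_fun [set: T] (fun x => complex.Im (f x)).

Definition L2sqnorm (f : T -> R[i]) : \bar R :=
  (\int[tau]_x (normc (f x) ^+ 2)%:E)%E.

(* Functions are not quotiented by almost everywhere equality: equality in
   L^2(tau) is expressed by the vanishing of L2sqnorm of the difference. *)
Definition inL2 (f : T -> R[i]) : Prop :=
  cmeasurable f /\ (L2sqnorm f < +oo)%E.

Definition cintegral (f : T -> R[i]) : R[i] :=
  Complex (\int[tau]_x complex.Re (f x)) (\int[tau]_x complex.Im (f x)).

Definition L2inner (f g : T -> R[i]) : R[i] :=
  cintegral (fun x => f x * conjc (g x)).

Definition L2_orthogonal_basis (I : choiceType) (D : set I)
    (u : I -> T -> R[i]) : Prop :=
  [/\ forall i, D i -> inL2 (u i) /\ L2sqnorm (u i) != 0%E,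
      forall i j, D i -> D j -> i != j -> L2inner (u i) (u j) = 0 &
      forall f, inL2 f -> forall eps : R, 0 < eps ->
        exists (s : seq I) (c : I -> R[i]),
          (forall i, i \in s -> D i) /\
          (L2sqnorm (fun x => f x - \sum_(i <- s) c i * u i x)%R
             < eps%:E)%E].

End ComplexL2.

(* R^d is d.-tuple R, whose measurable sets are generated by the coordinate
   projections; as R is second countable these are the Borel sets of R^d. *)
Section Spectral.
Context (R : realType) (d : nat).

Definition dotp (l x : d.-tuple R) : R := \sum_(i < d) tnth l i * tnth x i.

Definition expo (l x : d.-tuple R) : R[i] :=
  Complex (cos (2 * pi * dotp l x)) (sin (2 * pi * dotp l x)).

Definition is_spectrum (tau : {measure set (d.-tuple R) -> \bar R})
    (L : set (d.-tuple R)) : Prop :=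
  countable L /\ L2_orthogonal_basis tau L expo.

Definition spectral_measure (tau : {measure set (d.-tuple R) -> \bar R}) :
    Prop :=
  fin_num_fun tau /\ exists L, is_spectrum tau L.

End Spectral.

Section PlusUnitInterval.
Context (R : realType).

Definition plus_unit (A : set nat) : set R :=
  [set a%:R + t | a in A & t in `[0, 1]].

Lemma measurable_plus_unit (A : set nat) : measurable (plus_unit A).
Proof.
have -> : plus_unit A = \bigcup_(a in A) `[a%:R, a%:R + 1]%classic.
  apply/seteqP; split => x /=.
    case=> a Aa [t]; rewrite /= in_itv /= => /andP[t0 t1] <-.
    by exists a => //=; rewrite in_itv /= lerDl t0 lerD2l.
  case=> a Aa /=; rewrite in_itv /= => /andP[ax xa].
  exists a => //; exists (x - a%:R); last by rewrite addrC subrK.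
  by rewrite /= in_itv /= subr_ge0 ax lerBlDl.
exact: bigcup_measurable.
Qed.

(* Lebesgue measure is carried by measurableTypeR R, that is R with its Borel
   sigma-algebra. *)
Definition lebesgue_on_plus_unit (A : set nat) :
    {measure set (measurableTypeR R) -> \bar R} :=
  mrestr (@lebesgue_measure R) (measurable_plus_unit A).

End PlusUnitInterval.

Section ProductMeasure.
Context (R : realType) (m : nat).

(* The library's product measure lives on R * R^m; glue transports it to
   R^(1 + m). *)
Definition glue (x : measurableTypeR R * m.-tuple R) : (1 + m).-tuple R :=
  [tuple of x.1 :: x.2].

Lemma measurable_glue : measurable_fun setT glue.
Proof.
have m1 : @measurable_fun _ _ (measurableTypeR R * m.-tuple R)%type R setT fst.
  exact: measurable_fst.
exact: (measurable_cons m1 measurable_snd).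
Qed.

Variable mu : {measure set (measurableTypeR R) -> \bar R}.
Variable nu : {finite_measure set (m.-tuple R) -> \bar R}.

Definition tuple_product : set ((1 + m).-tuple R) -> \bar R :=
  pushforward (mu \x nu)%E glue.

Let tuple_product0 : tuple_product set0 = 0%E.
Proof. by rewrite /tuple_product /pushforward preimage_set0 measure0. Qed.

Let tuple_product_ge0 X : (0 <= tuple_product X)%E.
Proof.
have mglue := measurable_glue.
exact: measure_ge0.
Qed.

Let tuple_product_sigma_additive : semi_sigma_additive tuple_product.
Proof.
have mglue := measurable_glue.
exact: measure_semi_sigma_additive.
Qed.

HB.instance Definition _ := isMeasure.Build _ _ _ tuple_product
  tuple_product0 tuple_product_ge0 tuple_product_sigma_additive.

End ProductMeasure.

(* Main.v *)
Require Import Defs.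
From HB Require Import structures.
From mathcomp Require Import all_boot all_order all_algebra.
From mathcomp Require Import all_classical all_reals all_analysis.
From mathcomp Require Import complex.
From mathcomp Require Import measurable_realfun zify ring lra.

(**
Write e(x) = exp(2 pi i x), mu for Lebesgue measure on A + [0,1], mu^ for the
integral of e(tx) against mu, and L for a spectrum of mu x nu.  Up to the
factor of the unit interval, mu^(t) is the value at z = e(t) of the polynomial
A(z), the sum of z^a over a in A.  Since A(z)B(z) = (z^N - 1)/(z - 1), the zeros
of mu^ lie in (1/N)Z.  The block structure of complementary pairs provides a set
S of N/|A| integers such that (s - s')/N is never a zero of mu^ for s, s' in S.
The spectrum of nu is the set of all l for which some (t, l) in L has
floor(N t) in S.

Orthogonality: if (t, l) and (t', l') in L are distinct, then either l and l'
are orthogonal in L^2(nu), or mu^(t - t') = 0.  For frequencies with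
floor(N t) in S the latter is impossible.  The same holds if S is translated by
an integer that depends only on the class of t modulo (1/N)Z.

Completeness: fix g in L^2(nu) and apply Parseval's formula in L^2(mu x nu) to
f e(s x/N) (x) g, where f is the indicator of a short interval, and sum over s
in S.  Bessel's inequality for f on [0, N] turns the result into a weighted
average, over translates of S in each class modulo (1/N)Z, of the sums of
|<g, e_l>|^2 over the selected l.  As |S||A| = N, this average equals the upper
bound which Bessel's inequality in L^2(nu) gives for every choice of translates;
hence each translate attains it, in particular the untranslated one.
*)

Set Implicit Arguments.
Unset Strict Implicit.
Unset Printing Implicit Defensive.

Import Order.TTheory GRing.Theory Num.Theory.
Import ComplexField.Normc.
Import numFieldNormedType.Exports.

Local Open Scope classical_set_scope.
Local Open Scope ring_scope.

(** * Tilings of an interval of integers *)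

Section Tiling.
Local Open Scope nat_scope.

(** Direct sum decomposition of [0, N). For uniqueness it suffices to compare the first summands, by
    cancellation; boolean predicates can filter the big sums below. *)
Definition tiles (N : nat) (p q : pred nat) : Prop :=
  [/\ forall a b, p a -> q b -> a + b < N,
      forall n, n < N -> exists a b, [/\ p a, q b & n = a + b] &
      forall a b a' b', p a -> q b -> p a' -> q b' ->
        a + b = a' + b' -> a = a'].

Lemma tilesC N p q : tiles N p q -> tiles N q p.
Proof.
case=> lt ex un; split.
- by move=> a b qa pb; rewrite addnC; exact: lt.
- by move=> n /ex[a [b [pa qb ->]]]; exists b, a; split=> //; rewrite addnC.
- move=> a b a' b' qa pb qa' pb' e.
  have := un _ _ _ _ pb qa pb' qa'; lia.
Qed.

Lemma tiles0 N p q : 0 < N -> tiles N p q -> p 0 /\ q 0.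
Proof.
move=> N0 [_ /(_ 0 N0)[a [b [pa qb e]]] _].
have a0 : a = 0 by lia.
have b0 : b = 0 by lia.
by rewrite -{1}a0 -b0.
Qed.

Lemma block_div r k j : j < r -> (r * k + j) %/ r = k.
Proof. by move=> jr; rewrite mulnC divnMDl ?divn_small ?addn0 //; lia. Qed.

(* [r] is the first gap of [p]; the claim is checked on one block
   [r k, r (k + 1)) after the other. *)
Lemma tiles_block N p q : 1 < N -> tiles N p q -> p 1 ->
  exists2 r, 1 < r &
    (forall n, p n = p (r * (n %/ r))) /\ (forall n, q n -> r %| n).
Proof.
move=> N1 tl p1; have [lt ex un] := tl.
have [p0 q0] := tiles0 (ltnW N1) tl.
have pN : exists n, ~~ p n.
  by exists N; apply/negP => /lt/(_ q0); rewrite addn0 ltnn.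
have [r npr rmin] := ex_minnP pN.
have pr j : j < r -> p j by case: (boolP (p j)) => // /rmin; lia.
have r1 : 1 < r by case: r npr {rmin pr} => [|[|r]]; rewrite ?p0 ?p1.
exists r => //.
have q_lt_r b : q b -> b < r -> b = 0.
  move=> qb br; have := un b 0 0 b (pr _ br) q0 p0 qb; lia.
have qr : r < N -> q r.
  move=> /ex[a [b [pa qb e]]].
  have b0 : b <> 0 by move=> b0; move: npr; rewrite e b0 addn0 pa.
  have [br|] := ltnP b r; first by have := q_lt_r _ qb br; lia.
  by move=> rb; have -> : r = b by lia.
(* On every block [r k, r (k + 1)) the predicate [p] is constant, and [q] can hold only at the left
   end. This is shown by strong induction on [k]. *)
suff H k : (forall j, j < r -> p (r * k + j) = p (r * k)) /\
           (forall j, j < r -> q (r * k + j) -> j = 0).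
  split=> n; have nr : n %% r < r by rewrite ltn_mod; lia.
    by rewrite {1}(divn_eq n r) mulnC (H _).1.
  by rewrite {1}(divn_eq n r) mulnC => /(H _).2 e; rewrite /dvdn e.
elim/ltn_ind: k => k IH.
have pIH n : n < r * k -> p n = p (r * (n %/ r)).
  move=> nk; rewrite {1}(divn_eq n r) mulnC (IH _ _).1 ?ltn_mod; last by lia.
    by [].
  by rewrite ltn_divLR; lia.
have qIH n : n < r * k -> q n -> n = r * (n %/ r).
  move=> nk qn; have dk : n %/ r < k by rewrite ltn_divLR; lia.
  have nr : n %% r < r by rewrite ltn_mod; lia.
  have := (IH _ dk).2 _ nr; rewrite mulnC -divn_eq => /(_ qn) e.
  by rewrite {1}(divn_eq n r) e addn0 mulnC.
case: (posnP k) => [->|k0].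
  rewrite muln0; split=> j jr; first by rewrite add0n p0 pr.
  by rewrite add0n => /q_lt_r; exact.
have [rkN|Nrk] := ltnP (r * k) N; last first.
  have np n : N <= n -> p n = false.
    by move=> Nn; apply/negP => /lt/(_ q0); lia.
  split=> j jr; first by rewrite !np //; lia.
  by move=> /(lt _ _ p0); lia.
have rN : r < N by nia.
have {}qr := qr rN.
have [a [b [pa qb e]]] := ex _ rkN.
(* Here [r * k] is in [q]. Added to 0, ..., r - 1 in [p] it represents the whole block, so the block
   misses [p], and [q] has no other element in it. *)
have [a0|a0] := posnP a.
  have {}qb : q (r * k) by rewrite e a0.
  have np j : j < r -> p (r * k + j) = false.
    move=> jr; apply/negP => h.
    by have := un _ _ _ _ h q0 (pr _ jr) qb; nia.
  split=> j jr; first by rewrite np // -[r * k]addn0 np //; lia.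
  move=> h; have := un _ _ _ _ p0 h (pr _ jr) qb; lia.
(* Here [r * k] is in [p]. If r k + j with j > 0 were in [q], then r k + r would also equal (r - j)
   + (r k + j). The rest of the block is put in [p] by ruling out every nonzero [b'] in r k + j = a'
   + b'. *)
have [b0|b0] := posnP b.
  have {}pa : p (r * k) by rewrite e b0 addn0.
  have nq j : j < r -> q (r * k + j) -> j = 0.
    case: (posnP j) => // j0 jr h.
    have := un _ _ _ _ pa qr (pr (r - j) _) h; nia.
  have lN := lt _ _ pa qr.
  split=> // j jr; rewrite pa.
  have [a' [b' [pa' qb' e']]] : exists a b, [/\ p a, q b & r * k + j = a + b].
    by apply: ex; lia.
  have [b'0|b'0] := posnP b'; first by rewrite e' b'0 addn0.
  have [b'k|kb'] := ltnP b' (r * k); last first.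
    have z : b' - r * k = 0 by apply: nq; [lia|rewrite subnKC].
    have eb' : b' = r * k by lia.
    have := un _ _ _ _ pa q0 p0 qb'; lia.
  (* A nonzero [b'] below the block is r c by induction; this puts r (k - c) in [p] and represents r
     k twice. *)
  have eb := qIH _ b'k qb'.
  set c := b' %/ r in eb.
  have ck : c < k by nia.
  have ea : a' = r * (k - c) + j by nia.
  have pc : p (r * (k - c)).
    by move: pa'; rewrite ea (IH _ _).1 //; nia.
  have := un _ _ _ _ pc qb' pa q0; rewrite mulnBr; lia.
(* Both summands are positive. By induction r k = r (k - c) + r c, with a full block of [p] at r (k
   - c); its translate by r c fills block [k], which therefore misses both [p] and [q]. *)
have eb := qIH b (ltac:(lia)) qb.
set c := b %/ r in eb.
have ck : c < k by nia.
have c0 : 0 < c by nia.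
have ea : a = r * (k - c) by nia.
have pj j : j < r -> p (a + j).
  by move=> jr; rewrite ea (IH _ _).1 -?ea //; nia.
have np j : j < r -> p (r * k + j) = false.
  move=> jr; apply/negP => h.
  by have := un _ _ _ _ h q0 (pj _ jr) qb; nia.
split=> j jr; first by rewrite np // -[r * k]addn0 np //; lia.
move=> h; have := un _ _ _ _ p0 h (pj _ jr) qb; lia.
Qed.

(** One step of the block structure: [p] consists of full blocks of length [r], [q] is a dilate by
    [r], and the block indices tile a shorter interval. Later facts on tilings are inductions along
    this step, with [tilesC] when 1 lies in [q]. *)
Lemma tiles_quotient N p q : 1 < N -> tiles N p q -> p 1 ->
  exists r M, [/\ 1 < r, 0 < M & N = r * M] /\
    [/\ forall n, p n = p (r * (n %/ r)), forall n, q n -> r %| n &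
    tiles M (fun k => p (r * k)) (fun k => q (r * k))].
Proof.
move=> N1 tl p1; have [r r1 [pE qE]] := tiles_block N1 tl p1.
have [lt ex un] := tl; have [p0 q0] := tiles0 (ltnW N1) tl.
have full a j : j < r -> p a -> p (r * (a %/ r) + j).
  move=> jr; have e : (r * (a %/ r) + j) %/ r = a %/ r.
    exact: block_div.
  by rewrite [p (_ + _)]pE e -pE.
(* The largest sum N - 1 must end its block: otherwise the last element of the block of [a], added
   to [b], would exceed it. Hence [r] divides N. *)
have [M eN] : exists M, N = r * M.
  have [|a [b [pa qb e]]] := ex N.-1; first by lia.
  have /dvdnP[c eb] := qE _ qb.
  have := lt _ _ (full a r.-1 (ltac:(lia)) pa) qb.
  have := divn_eq a r; have : a %% r < r by rewrite ltn_mod; lia.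
  move=> h1 h2 h3; exists (a %/ r + c).+1; nia.
exists r, M; split; [split=> //; nia|split=> //; split].
- move=> a b pa qb; have := lt _ _ pa qb; nia.
- move=> n nM; have [|a [b [pa qb e]]] := ex (r * n); first by nia.
  have /dvdnP[c eb] := qE _ qb.
  have /dvdnP[a' ea] : r %| a.
    by rewrite -(dvdn_addl _ (qE _ qb)) -e dvdn_mulr.
  exists a', c; rewrite mulnC -ea mulnC -eb; split=> //; nia.
- move=> a b a' b' pa qb pa' qb' e; have := un _ _ _ _ pa qb pa' qb'; nia.
Qed.

Local Open Scope ring_scope.

Lemma sum_blocks (V : nmodType) (r M : nat) (F : nat -> V) :
  \sum_(0 <= n < r * M) F n =
  \sum_(0 <= k < M) \sum_(0 <= j < r) F (r * k + j)%N.
Proof.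
elim: M => [|M IH]; first by rewrite muln0 !big_geq.
rewrite big_nat_recr //= -IH mulnS addnC (big_cat_nat _ (leq_addr r (r * M))) //=.
congr (_ + _); rewrite -{1}[(r * M)%N]add0n big_addn addKn.
by apply: eq_bigr => j _; rewrite addnC.
Qed.

(** * Mask polynomials at roots of unity *)

Section RootsOfUnity.
Variable K : numFieldType.
Implicit Types (z w : K) (p q : pred nat).

Definition gensum N p z : K := \sum_(0 <= n < N | p n) z ^+ n.

(** The exponents are r k + j with [j] ranging over all of [0, r), so the polynomial of this direct
    sum is a product. *)
Lemma gensum_block r M p z :
  (forall n, p n = p (r * (n %/ r))%N) -> (0 < r)%N ->
  gensum (r * M) p z =
  (\sum_(0 <= j < r) z ^+ j) * gensum M (fun k => p (r * k)%N) (z ^+ r).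
Proof.
move=> pE r0; rewrite /gensum big_mkcond sum_blocks mulr_sumr [RHS]big_mkcond.
apply: eq_bigr => k _.
transitivity (\sum_(0 <= j < r) (if p (r * k)%N then z ^+ (r * k) * z ^+ j else 0)).
  rewrite !big_nat; apply: eq_bigr => j /andP[_ jr].
  by rewrite pE block_div // exprD.
case: ifP => _; last by rewrite big1.
by rewrite -mulr_sumr mulrC exprM.
Qed.

Lemma gensum_dvd r M p z :
  (forall n, p n -> r %| n)%N -> (0 < r)%N ->
  gensum (r * M) p z = gensum M (fun k => p (r * k)%N) (z ^+ r).
Proof.
move=> pE r0; rewrite /gensum big_mkcond sum_blocks [RHS]big_mkcond.
apply: eq_bigr => k _; case: r r0 pE => // r _ pE.
rewrite big_nat_recl // addn0 -exprM big_nat big1 ?addr0 // => j /andP[_ jr].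
case: ifP => // /pE; rewrite dvdn_addr ?dvdn_mulr // => /dvdn_leq; lia.
Qed.


Lemma geom_unity r z : \sum_(0 <= j < r) z ^+ j = 0 -> z ^+ r = 1.
Proof.
rewrite big_mkord => e; apply/eqP; rewrite -subr_eq0.
by rewrite subrX1 e mulr0.
Qed.

(** By induction along the quotient tiling: a zero is either a zero of a geometric sum, hence an
    [r]-th root of unity, or its [r]-th power is a zero for the quotient tiling of length M. Either
    way its power of order r M = N is 1. *)
Lemma gensum_eq0 N p q z :
  (0 < N)%N -> tiles N p q -> gensum N p z = 0 -> z ^+ N = 1.
Proof.
elim/ltn_ind: N p q z => N IH p q z N0 tl.
have [N1|N1] := leqP N 1.
  have -> : N = 1%N by lia.
  have [p0 _] := tiles0 N0 tl.
  rewrite /gensum big_mkcond big_nat1 p0 => /eqP; by rewrite oner_eq0.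
have [a [b [pa qb e]]] : exists a b, [/\ p a, q b & (1 = a + b)%N].
  by case: tl => _ /(_ 1%N N1).
have [e1|e1] : a = 1%N \/ b = 1%N by lia.
- rewrite e1 in pa.
  have [r [M [[r1 M0 eN] [pE qE tl']]]] := tiles_quotient N1 tl pa.
  rewrite eN gensum_block; [|by []|by lia].
  move=> /eqP; rewrite mulf_eq0 => /orP[] /eqP.
    by move=> /geom_unity h; rewrite exprM h expr1n.
  by move=> /(IH M _ _ _ _ M0 tl'); rewrite -exprM; apply; nia.
- rewrite e1 in qb.
  have [r [M [[r1 M0 eN] [qE pE tl']]]] := tiles_quotient N1 (tilesC tl) qb.
  rewrite eN gensum_dvd; [|by []|by lia].
  by move=> /(IH M _ _ _ _ M0 (tilesC tl')); rewrite -exprM; apply; nia.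
Qed.

(* When [p] is made of full blocks of length [r] the set for the quotient
   tiling works; when [p] is a dilate, its translates by the multiples of [M]
   are added. *)
Lemma tiles_nonvanishing N p q : (0 < N)%N -> tiles N p q ->
  exists S : seq nat, [/\ uniq S, all (fun s => s < N)%N S,
    (size S)%:R * gensum N p 1 = N%:R &
    forall w : K, N.-primitive_root w ->
      {in S &, forall s s', s != s' -> gensum N p (w ^+ s / w ^+ s') != 0}].
Proof.
elim/ltn_ind: N p q => N IH p q N0 tl.
have [N1|N1] := leqP N 1.
  have eN : N = 1%N by lia.
  have [p0 _] := tiles0 N0 tl.
  exists [:: 0%N]; split; rewrite ?eN //.
    by rewrite /gensum big_mkcond big_nat1 p0 mulr1.
  by move=> w _ s s'; rewrite !inE => /eqP-> /eqP->; rewrite eqxx.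
have unityX (w : K) n s s' : w ^+ n = 1 -> (w ^+ s / w ^+ s') ^+ n = 1.
  by move=> h; rewrite expr_div_n -!exprM ![(_ * n)%N]mulnC !exprM h !expr1n divr1.
have [a [b [pa qb e]]] : exists a b, [/\ p a, q b & (1 = a + b)%N].
  by case: tl => _ /(_ 1%N N1).
have [e1|e1] : a = 1%N \/ b = 1%N by lia.
- rewrite e1 in pa.
  have [r [M [[r1 M0 eN] [pE qE tl']]]] := tiles_quotient N1 tl pa.
  have MN : (M < N)%N by nia.
  have [S [uS ltS cS nzS]] := IH M MN _ _ M0 tl'.
  exists S; split=> //.
  + by apply: sub_all ltS => s sM; lia.
  + rewrite eN gensum_block; [|by []|by lia].
    rewrite expr1n mulrCA cS natrM; congr (_ * _).
    rewrite (eq_bigr (fun=> 1)) => [|i _]; last by rewrite expr1n.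
    by rewrite sumr_const_nat subn0.
  + move=> w pw s s' sS s'S ss'.
    rewrite eN gensum_block; [|by []|by lia].
    have pwr : M.-primitive_root (w ^+ r).
      have := dvdn_prim_root pw; move=> /(_ M); rewrite eN mulnK // => -> //.
      by rewrite dvdn_mull.
    have er : (w ^+ s / w ^+ s') ^+ r = (w ^+ r) ^+ s / (w ^+ r) ^+ s'.
      by rewrite expr_div_n -!exprM ![(_ * r)%N]mulnC.
    rewrite er mulf_neq0 //; last exact: nzS.
    (* If the geometric factor vanished, the powers of exponents [s] and [s'] of the primitive
       [M]-th root w^r would agree, although both exponents are below [M]. *)
    apply/eqP => /geom_unity; rewrite er => /divr1_eq /eqP.
    rewrite (eq_prim_root_expr pwr).
    have [/allP/(_ _ sS) h /allP/(_ _ s'S) h'] := conj ltS ltS.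
    by rewrite !modn_small //; exact/negP.
- rewrite e1 in qb.
  have [r [M [[r1 M0 eN] [qE pE tl']]]] := tiles_quotient N1 (tilesC tl) qb.
  have MN : (M < N)%N by nia.
  have [S [uS ltS cS nzS]] := IH M MN _ _ M0 (tilesC tl').
  exists [seq (s + M * j)%N | s <- S, j <- iota 0 r]; split.
  + apply: allpairs_uniq => //; first exact: iota_uniq.
    move=> [s j] [s' j'] /allpairsP[x [xS _ [-> ->]]] /allpairsP[y [yS _ [-> ->]]] /=.
    have [/allP/(_ _ xS) h /allP/(_ _ yS) h'] := conj ltS ltS.
    move=> e2; have e3 : x.1 = y.1.
      have := congr1 (modn^~ M) e2.
      by rewrite /= ![(_ + M * _)%N]addnC ![(M * _)%N]mulnC !modnMDl !modn_small.
    by move: e2 => /=; rewrite e3 => /addnI/eqP; rewrite eqn_pmul2l // => /eqP->. 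
  + apply/allP => x /allpairsP[[s j] /= [/(allP ltS) /= h]].
    rewrite mem_iota => /andP[_ jr] ->.
    have : (M * j.+1 <= M * r)%N by rewrite leq_mul2l orbC; lia.
    by rewrite eN; lia.
  + rewrite size_allpairs size_iota eN gensum_dvd; [|by []|by lia].
    by rewrite expr1n mulnC !natrM -mulrA cS.
  + move=> w pw x y /allpairsP[[s j] /= [sS jr ->]].
    move=> /allpairsP[[s' j'] /= [s'S j'r ->]] ss'.
    rewrite eN gensum_dvd; [|by []|by lia].
    have pwr : M.-primitive_root (w ^+ r).
      have := dvdn_prim_root pw; move=> /(_ M); rewrite eN mulnK // => -> //.
      by rewrite dvdn_mull.
    (* Taking [r]-th powers forgets the multiple of [M], because r M = N. *)
    have er i k : (w ^+ (i + M * k)) ^+ r = (w ^+ r) ^+ i.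
      by rewrite -!exprM mulnDl exprD mulnAC (mulnC M r) -eN [X in _ * X]exprM
         (prim_expr_order pw) expr1n mulr1 mulnC.
    rewrite expr_div_n !er.
    (* For two translates of one [s] the argument is 1, where the value is nonzero by the
       cardinality identity [cS]. *)
    have [ess|ess] := eqVneq s s'; last exact: nzS.
    rewrite -ess divff ?expf_neq0 //; last first.
      apply/eqP => z0; move: (oner_eq0 K).
      by rewrite -[X in X == _](prim_expr_order pw) z0 expr0n gtn_eqF // eqxx.
    apply/eqP => z; move: cS; rewrite z mulr0 => /esym/eqP.
    by rewrite pnatr_eq0; lia.
Qed.

End RootsOfUnity.
End Tiling.

(** * An averaging inequality for finite sums *)

Section Averaging.
Variable R : realFieldType.

Lemma seq_argmax (T : eqType) (x0 : T) (K : seq T) (G : T -> R) :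
  exists2 k, k \in x0 :: K & {in x0 :: K, forall k', G k' <= G k}.
Proof.
elim: K => [|x K [k kK kmax]].
  by exists x0; rewrite ?mem_head // => k'; rewrite inE => /eqP->.
have [Gx|Gx] := leP (G x) (G k).
  exists k; first by move: kK; rewrite !inE orbCA => ->; rewrite orbT.
  by move=> k'; rewrite !inE orbCA => /orP[/eqP->//|h]; apply: kmax; rewrite inE.
exists x; first by rewrite !inE eqxx orbT.
move=> k'; rewrite !inE orbCA => /orP[/eqP->//|h].
by apply/ltW/(le_lt_trans _ Gx)/kmax; rewrite inE.
Qed.

Lemma sum_fibers (I J : eqType) (F : seq I) (P : pred I) (h : I -> J) (a : I -> R) :
  \sum_(x <- F | P x) a x =
  \sum_(y <- undup (map h F)) \sum_(x <- F | P x && (h x == y)) a x.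
Proof.
rewrite [RHS](exchange_big_dep P) => [|y x _ /andP[]//].
rewrite [LHS]big_seq_cond [RHS]big_seq_cond; apply: eq_bigr => x /andP[xF Px].
rewrite (eq_bigl (pred1 (h x))) => [|y]; last by rewrite /= Px eq_sym.
by rewrite -big_filter filter_pred1_uniq ?undup_uniq ?mem_undup ?map_f // big_seq1.
Qed.

Lemma sum_subseq_le (I : eqType) (F F' : seq I) (w : I -> R) :
  uniq F -> uniq F' -> {subset F <= F'} -> (forall x, 0 <= w x) ->
  \sum_(x <- F) w x <= \sum_(x <- F') w x.
Proof.
move=> uF uF' sub w0; rewrite [leRHS](bigID (mem F)) /=.
have <- : \sum_(x <- F) w x = \sum_(x <- F' | x \in F) w x.
  rewrite -[RHS]big_filter; apply: perm_big; apply: uniq_perm => //.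
    exact: filter_uniq.
  by move=> x; rewrite mem_filter /= andb_idr //; exact: sub.
by rewrite lerDl sumr_ge0.
Qed.

(* [S] is shifted by an integer depending only on the class [fr x]; choosing
   the best shift in every class bounds all other choices at once. *)
Lemma averaging (I : eqType) (F : seq I) (S : seq nat) (w : I -> R)
    (fl : I -> int) (fr : I -> R) (phi : R -> R) (W B c : R) :
  let inS (z : int) := z \in map Posz S in
  (forall x, 0 <= w x) -> (forall v, 0 <= phi v) -> uniq S -> 0 <= c <= B ->
  (forall k : R -> int, \sum_(x <- F | inS (fl x - k (fr x))) w x <= W) ->
  (forall v (K : seq int), uniq K -> \sum_(k <- K) phi (v + k%:~R) <= B) ->
  (forall x, c <= phi (fr x)) ->
  \sum_(s <- S) \sum_(x <- F) phi (fr x + (fl x - Posz s)%:~R) * w x <=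
  (B - c) * W + c * \sum_(x <- F | inS (fl x)) w x.
Proof.
move=> inS w0 phi0 uS /andP[c0 cB] bes bphi lphi.
pose K0 := [seq fl x - Posz s | x <- F, s <- S].
(* [G v k] is the weight that the shift [k] selects in the class [v]. The best shift is sought in a
   finite list containing 0, so that the unshifted choice competes. *)
pose G v k := \sum_(x <- F | inS (fl x - k) && (fr x == v)) w x.
have /choice[k kP] v : exists k, {in (0 : int) :: K0, forall k', G v k' <= G v k}.
  by have [k _ h] := seq_argmax 0 K0 (G v); exists k.
pose K := undup (0 :: K0).
have uK : uniq K by exact: undup_uniq.
(* Substitute j = fl x - s; [K] contains every integer that arises in this way. *)
have KE x : x \in F -> \sum_(s <- S) phi (fr x + (fl x - Posz s)%:~R) =
    \sum_(j <- K | inS (fl x - j)) phi (fr x + j%:~R).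
  move=> xF; rewrite -[RHS]big_filter.
  rewrite -(big_map (fun s => fl x - Posz s) xpredT (fun j => phi (fr x + j%:~R))).
  apply: perm_big; apply: uniq_perm.
  - by rewrite map_inj_uniq // => s s' e; lia.
  - exact: filter_uniq.
  move=> j; rewrite mem_filter mem_undup /inS.
  apply/mapP/andP => [[s sS ->]|[/mapP[s sS e] _]].
    split; first by rewrite opprB addrC subrK map_f.
    by rewrite inE; apply/orP; right; apply/allpairsP; exists (x, s).
  by exists s => //; lia.
rewrite exchange_big /= (sum_fibers _ xpredT fr) /=.
rewrite [X in c * X](sum_fibers _ _ fr) mulr_sumr.
(* The best shifts of all classes form a single function of the class, to which [bes] applies. *)
have mE : \sum_(v <- undup (map fr F)) G v (k v) <= W.
  rewrite (le_trans _ (bes k)) // (sum_fibers _ _ fr).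
  rewrite le_eqVlt; apply/orP; left; apply/eqP.
  apply: eq_bigr => v _; apply: eq_bigl => x.
  by case: eqP => [->|]; rewrite ?andbF.
apply: le_trans (_ : _ <= (B - c) * \sum_(v <- undup (map fr F)) G v (k v) +
   \sum_(v <- undup (map fr F)) c * G v 0) _; last first.
  rewrite lerD ?ler_wpM2l ?subr_ge0 //.
  by apply: ler_sum => v _; rewrite /G; under eq_bigl do rewrite subr0.
rewrite mulr_sumr -big_split /= big_seq [leRHS]big_seq.
apply: ler_sum => v; rewrite mem_undup => /mapP[x0 _ ev].
have -> : \sum_(x <- F | fr x == v) \sum_(s <- S) phi (fr x + (fl x - Posz s)%:~R) * w x =
    \sum_(j <- K) phi (v + j%:~R) * G v j.
  transitivity (\sum_(x <- F | fr x == v) \sum_(j <- K)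
      (if inS (fl x - j) then phi (v + j%:~R) * w x else 0)).
    rewrite big_seq_cond [RHS]big_seq_cond; apply: eq_bigr => x /andP[xF /eqP <-].
    rewrite -mulr_suml KE // mulr_suml big_mkcond.
    by apply: eq_bigr => j _; case: ifP; rewrite ?mul0r.
  rewrite exchange_big; apply: eq_bigr => j _.
  rewrite -big_mkcondr mulr_sumr.
  by apply: eq_bigl => x; rewrite andbC.
(* All deficits [G v (k v) - G v j] are nonnegative, so only the term j = 0 is kept. As the values
   of [phi] sum to at most [B] and c <= phi v, the class contributes at most (B - c) G v (k v) + c G
   v 0. *)
have h1 : \sum_(j <- K) phi (v + j%:~R) * (G v (k v) - G v j) >=
    phi v * (G v (k v) - G v 0).
  have K00 : 0 \in K by rewrite mem_undup mem_head.
  rewrite (bigD1_seq 0) //= addr0 lerDl big_seq_cond sumr_ge0 // => j /andP[jK _].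
  by rewrite mulr_ge0 // subr_ge0 kP // -mem_undup.
have h2 : \sum_(j <- K) phi (v + j%:~R) * G v (k v) <= B * G v (k v).
  rewrite -mulr_suml ler_wpM2r ?bphi //; exact: sumr_ge0.
have h3 : c * (G v (k v) - G v 0) <= phi v * (G v (k v) - G v 0).
  rewrite ler_wpM2r //; last by rewrite ev.
  by rewrite subr_ge0 kP // mem_head.
move: h1; under eq_bigr do rewrite mulrBr; rewrite big_split /= sumrN.
by move: h2 h3; lra.
Qed.

End Averaging.

(** * Square integrable complex functions *)

Local Open Scope complex_scope.
(* Inside products the library would read [^*] as [Num.conj]. *)
Local Notation "x ^*" := (conjc x) : ring_scope.
Local Arguments normc : simpl never.

Section ComplexFacts.
Variable R : realType.
Implicit Types x y : R[i].

Lemma cReD x y : complex.Re (x + y) = complex.Re x + complex.Re y.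
Proof. by case: x y => a b []. Qed.
Lemma cImD x y : complex.Im (x + y) = complex.Im x + complex.Im y.
Proof. by case: x y => a b []. Qed.
Lemma cReN x : complex.Re (- x) = - complex.Re x.
Proof. by case: x. Qed.
Lemma cImN x : complex.Im (- x) = - complex.Im x.
Proof. by case: x. Qed.
Lemma cReM x y : complex.Re (x * y) =
  complex.Re x * complex.Re y - complex.Im x * complex.Im y.
Proof. by case: x y => a b []. Qed.
Lemma cImM x y : complex.Im (x * y) =
  complex.Re x * complex.Im y + complex.Im x * complex.Re y.
Proof. by case: x y => a b []. Qed.
Lemma cRe_conj x : complex.Re (x^*) = complex.Re x. Proof. by case: x. Qed.
Lemma cIm_conj x : complex.Im (x^*) = - complex.Im x. Proof. by case: x. Qed.

Lemma normc_sqr x : normc x ^+ 2 = complex.Re x ^+ 2 + complex.Im x ^+ 2.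
Proof. by case: x => a b; rewrite /normc sqr_sqrtr // addr_ge0 ?sqr_ge0. Qed.

Lemma normc_conj x : normc (x^*) = normc x.
Proof. by case: x => a b; rewrite /normc /= sqrrN. Qed.

Lemma complex_ext x y :
  complex.Re x = complex.Re y -> complex.Im x = complex.Im y -> x = y.
Proof. by case: x y => a b [c d] /= -> ->. Qed.

(** Finite sums in [L2_orthogonal_basis] may repeat indices, while the identities below need
    distinct ones; multiplicities are absorbed into the coefficients. *)
Lemma sum_undup (T : Type) (I : eqType) (s : seq I) (F : I -> T -> R[i]) c :
  exists c' : I -> R[i], forall t,
    \sum_(i <- s) c i * F i t = \sum_(i <- undup s) c' i * F i t.
Proof.
exists (fun i => c i * (count_mem i s)%:R) => t.
rewrite -big_undup_iterop_count; apply: eq_bigr => i _.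
rewrite Monoid.iteropE mulrAC mulr_natr.
by elim: (count_mem i s) => //= n ->; rewrite mulrS.
Qed.

End ComplexFacts.

Section ComplexIntegral.
Context d (T : measurableType d) (R : realType).
Variable tau : {measure set T -> \bar R}.
Implicit Types f g h : T -> R[i].

Definition cintegrable f : Prop :=
  tau.-integrable setT (EFin \o (fun x => complex.Re (f x))) /\
  tau.-integrable setT (EFin \o (fun x => complex.Im (f x))).

Lemma cintegralD f g : cintegrable f -> cintegrable g ->
  cintegral tau (fun x => f x + g x) = cintegral tau f + cintegral tau g.
Proof.
move=> [f1 f2] [g1 g2]; rewrite /cintegral; apply: complex_ext => /=.
- by rewrite -RintegralD //; apply: eq_Rintegral => x _; rewrite cReD.
- by rewrite -RintegralD //; apply: eq_Rintegral => x _; rewrite cImD.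
Qed.

Lemma integrableZlEFin k (f : T -> R) : tau.-integrable setT (EFin \o f) ->
  tau.-integrable setT (EFin \o (fun x => k * f x)).
Proof. by move/(integrableZl measurableT k). Qed.

Lemma cintegralZ c f : cintegrable f ->
  cintegral tau (fun x => c * f x) = c * cintegral tau f.
Proof.
move=> [f1 f2]; rewrite /cintegral; apply: complex_ext.
- rewrite cReM /= -!RintegralZl // -RintegralB //; first last.
  + exact: integrableZlEFin.
  + exact: integrableZlEFin.
  by apply: eq_Rintegral => x _; rewrite cReM.
- rewrite cImM /= -!RintegralZl // -RintegralD //; first last.
  + exact: integrableZlEFin.
  + exact: integrableZlEFin.
  by apply: eq_Rintegral => x _; rewrite cImM.
Qed.

Lemma cintegral_conj f : cintegrable f ->
  cintegral tau (fun x => (f x)^*) = (cintegral tau f)^*.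
Proof.
move=> [f1 f2]; rewrite /cintegral; apply: complex_ext => /=.
- by apply: eq_Rintegral => x _; rewrite cRe_conj.
- rewrite -mulN1r -RintegralZl //.
  by apply: eq_Rintegral => x _; rewrite cIm_conj mulN1r.
Qed.

Lemma cmeasurableD f g : cmeasurable f -> cmeasurable g ->
  cmeasurable (fun x => f x + g x).
Proof.
move=> [f1 f2] [g1 g2]; split.
- under eq_fun do rewrite cReD; exact: measurable_funD.
- under eq_fun do rewrite cImD; exact: measurable_funD.
Qed.

Lemma cmeasurableM f g : cmeasurable f -> cmeasurable g ->
  cmeasurable (fun x => f x * g x).
Proof.
move=> [f1 f2] [g1 g2]; split.
- under eq_fun do rewrite cReM.
  by apply: measurable_funB; exact: measurable_funM.
- under eq_fun do rewrite cImM.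
  by apply: measurable_funD; exact: measurable_funM.
Qed.

Lemma cmeasurable_conj f : cmeasurable f -> cmeasurable (fun x => (f x)^*).
Proof.
move=> [f1 f2]; split.
- by under eq_fun do rewrite cRe_conj.
- by under eq_fun do rewrite cIm_conj; exact: measurable_funN.
Qed.

Lemma cmeasurable_cst c : cmeasurable (fun _ : T => c : R[i]).
Proof. by split; exact: measurable_cst. Qed.

Lemma measurable_normc_sqr f : cmeasurable f ->
  measurable_fun setT (fun x => normc (f x) ^+ 2).
Proof.
move=> [f1 f2]; under eq_fun do rewrite normc_sqr.
by apply: measurable_funD; exact: measurable_funX.
Qed.

Lemma inL2_integrable f : inL2 tau f ->
  tau.-integrable setT (EFin \o (fun x => normc (f x) ^+ 2)).
Proof.
move=> [mf foo]; apply/integrableP; split.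
  by apply/measurable_EFinP; exact: measurable_normc_sqr.
rewrite (eq_integral (fun x => (normc (f x) ^+ 2)%:E)) // => x _ /=.
by rewrite ger0_norm // sqr_ge0.
Qed.

Lemma inL2P f : cmeasurable f ->
  tau.-integrable setT (EFin \o (fun x => normc (f x) ^+ 2)) -> inL2 tau f.
Proof.
move=> mf /integrableP[_ foo]; split=> //.
rewrite /L2sqnorm (le_lt_trans _ foo)// le_eqVlt; apply/orP; left; apply/eqP.
apply: eq_integral => x _ /=; by rewrite ger0_norm // sqr_ge0.
Qed.

(** Real and imaginary part of the product are dominated by |f|^2 + |g|^2, since squares of sums and
    differences of the coordinates are nonnegative. *)
Lemma inL2_mul_integrable f g : inL2 tau f -> inL2 tau g ->
  cintegrable (fun x => f x * (g x)^*).
Proof.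
move=> Lf Lg; have [m1 m2] := cmeasurableM Lf.1 (cmeasurable_conj Lg.1).
have bound := integrableD measurableT (inL2_integrable Lf) (inL2_integrable Lg).
split.
- apply: (le_integrable measurableT _ _ bound); first exact/measurable_EFinP.
  move=> x _ /=; rewrite lee_fin [leRHS]ger0_norm ?addr_ge0 ?sqr_ge0 //.
  rewrite cReM cRe_conj cIm_conj !normc_sqr ler_norml.
  move: (complex.Re (f x)) (complex.Im (f x)) (complex.Re (g x)) (complex.Im (g x)) => a b c e.
  have h1 := sqr_ge0 (a + c); have h2 := sqr_ge0 (b + e).
  have h3 := sqr_ge0 (a - c); have h4 := sqr_ge0 (b - e).
  have [h5 h6 h7 h8] := And4 (sqr_ge0 a) (sqr_ge0 b) (sqr_ge0 c) (sqr_ge0 e).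
  by apply/andP; split; nra.
- apply: (le_integrable measurableT _ _ bound); first exact/measurable_EFinP.
  move=> x _ /=; rewrite lee_fin [leRHS]ger0_norm ?addr_ge0 ?sqr_ge0 //.
  rewrite cImM cRe_conj cIm_conj !normc_sqr ler_norml.
  move: (complex.Re (f x)) (complex.Im (f x)) (complex.Re (g x)) (complex.Im (g x)) => a b c e.
  have h1 := sqr_ge0 (a + e); have h2 := sqr_ge0 (b + c).
  have h3 := sqr_ge0 (a - e); have h4 := sqr_ge0 (b - c).
  have [h5 h6 h7 h8] := And4 (sqr_ge0 a) (sqr_ge0 b) (sqr_ge0 c) (sqr_ge0 e).
  by apply/andP; split; nra.
Qed.

Lemma inL2D f g : inL2 tau f -> inL2 tau g -> inL2 tau (fun x => f x + g x).
Proof.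
move=> Lf Lg; apply: inL2P; first exact: (cmeasurableD Lf.1 Lg.1).
have bound := integrableZl measurableT 2
  (integrableD measurableT (inL2_integrable Lf) (inL2_integrable Lg)).
apply: (le_integrable measurableT _ _ bound).
  by apply/measurable_EFinP/measurable_normc_sqr; exact: (cmeasurableD Lf.1 Lg.1).
move=> x _ /=; rewrite lee_fin ger0_norm ?sqr_ge0 //.
rewrite [leRHS]ger0_norm; last by rewrite mulr_ge0 ?addr_ge0 ?sqr_ge0.
rewrite !normc_sqr cReD cImD.
move: (complex.Re (f x)) (complex.Im (f x)) (complex.Re (g x)) (complex.Im (g x)) => a b c e.
by have h3 := sqr_ge0 (a - c); have h4 := sqr_ge0 (b - e); nra.
Qed.

Lemma inL2Z c f : inL2 tau f -> inL2 tau (fun x => c * f x).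
Proof.
move=> Lf; have mc := cmeasurableM (cmeasurable_cst c) Lf.1.
apply: inL2P => //.
have bound := integrableZl measurableT (normc c ^+ 2) (inL2_integrable Lf).
apply: (eq_integrable measurableT _ _ _ bound) => x _ /=.
by rewrite normcM exprMn.
Qed.

Lemma inL2_0 : inL2 tau (fun=> 0).
Proof.
apply: inL2P; first exact: cmeasurable_cst.
by under eq_fun do rewrite normc0 expr0n /=; exact: integrable0.
Qed.

Lemma inL2_sum (I : eqType) (s : seq I) (F : I -> T -> R[i]) :
  {in s, forall i, inL2 tau (F i)} -> inL2 tau (fun x => \sum_(i <- s) F i x).
Proof.
elim: s => [_|i s IH h]; first by under eq_fun do rewrite big_nil; exact: inL2_0.
under eq_fun do rewrite big_cons; apply: inL2D; first by apply: h; rewrite mem_head.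
by apply: IH => j js; apply: h; rewrite in_cons js orbT.
Qed.

Lemma L2innerDl f g h : inL2 tau f -> inL2 tau g -> inL2 tau h ->
  L2inner tau (fun x => f x + g x) h = L2inner tau f h + L2inner tau g h.
Proof.
move=> Lf Lg Lh; rewrite /L2inner -cintegralD; try exact: inL2_mul_integrable.
by congr cintegral; apply/funext => x; rewrite mulrDl.
Qed.

Lemma L2innerZl c f h : inL2 tau f -> inL2 tau h ->
  L2inner tau (fun x => c * f x) h = c * L2inner tau f h.
Proof.
move=> Lf Lh; rewrite /L2inner -cintegralZ; last exact: inL2_mul_integrable.
by congr cintegral; apply/funext => x; rewrite mulrA.
Qed.

Lemma L2inner_conj f g : inL2 tau f -> inL2 tau g ->
  L2inner tau g f = (L2inner tau f g)^*.
Proof.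
move=> Lf Lg; rewrite /L2inner -cintegral_conj; last exact: inL2_mul_integrable.
by congr cintegral; apply/funext => x; rewrite rmorphM /= conjcK mulrC.
Qed.

(** Real valued squared norm. Since [fine] sends infinity to 0, it determines [L2sqnorm] only for
    square integrable functions, through [L2sqnormE]. *)
Definition sqn f : R := fine (L2sqnorm tau f).

Lemma L2sqnormE f : inL2 tau f -> L2sqnorm tau f = (sqn f)%:E.
Proof.
move=> [mf foo]; rewrite /sqn fineK // ge0_fin_numE //.
by apply: integral_ge0 => x _; rewrite lee_fin sqr_ge0.
Qed.

Lemma sqn_ge0 f : 0 <= sqn f.
Proof. by apply: fine_ge0; apply: integral_ge0 => x _; rewrite lee_fin sqr_ge0. Qed.

Lemma L2inner_id f : L2inner tau f f = (sqn f)%:C.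
Proof.
rewrite /L2inner /cintegral; apply: complex_ext => /=.
- apply: eq_Rintegral => x _; rewrite cReM cRe_conj cIm_conj normc_sqr; ring.
- under eq_Rintegral do rewrite cImM cRe_conj cIm_conj mulrN mulrC addNr.
  by rewrite Rintegral_cst // mul0r.
Qed.

(* Completing the square. *)
Lemma sqn_sub1 f u c M : inL2 tau f -> inL2 tau u -> sqn u = M -> M != 0 ->
  sqn (fun x => f x - c * u x) = sqn f +
    (M * normc (c - L2inner tau f u / M%:C) ^+ 2 - normc (L2inner tau f u) ^+ 2 / M).
Proof.
move=> Lf Lu uM M0; have Lcu := inL2Z (- c) Lu.
have Lh : inL2 tau (fun x => f x - c * u x).
  by under eq_fun do rewrite -mulNr; exact: inL2D.
have eh : (fun x => f x - c * u x) = (fun x => f x + (- c) * u x).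
  by apply/funext => x; rewrite mulNr.
apply: complexI; rewrite -L2inner_id {1}eh L2innerDl // L2innerZl //.
rewrite (L2inner_conj Lh Lf) (L2inner_conj Lh Lu) eh !L2innerDl // !L2innerZl //.
rewrite !L2inner_id uM (L2inner_conj Lf Lu).
move: (L2inner tau f u) => [p q]; case: c {Lcu Lh eh} => a b.
have -> : (p +i* q) / M%:C = (p / M) +i* (q / M).
  apply: (mulIf (x := M%:C)); first by apply: contra M0 => /eqP[->].
  rewrite mulfVK; last by apply: contra M0 => /eqP[->].
  by apply: complex_ext; rewrite ?cReM ?cImM /= ?mulr0 ?subr0 ?add0r mulfVK.
rewrite !normc_sqr; apply: complex_ext;
  rewrite /= ?(cReM, cReD, cReN, cImM, cImD, cImN, cRe_conj, cIm_conj) /=;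
  by field.
Qed.

Lemma L2inner_sub_orth (I : eqType) (s : seq I) (u : I -> T -> R[i])
    (c : I -> R[i]) f h :
  inL2 tau f -> inL2 tau h -> {in s, forall i, inL2 tau (u i)} ->
  {in s, forall i, L2inner tau (u i) h = 0} ->
  L2inner tau (fun x => f x - \sum_(i <- s) c i * u i x) h = L2inner tau f h.
Proof.
move=> Lf Lh; elim: s => [_ _|i s IH Lu uh].
  by congr L2inner; apply/funext => x; rewrite big_nil subr0.
have is_ : i \in i :: s by rewrite mem_head.
have sub j : j \in s -> j \in i :: s by rewrite in_cons orbC => ->.
have LS : inL2 tau (fun x => f x - \sum_(i <- s) c i * u i x).
  under eq_fun do rewrite -mulN1r; apply: inL2D => //; apply: inL2Z.
  by apply: inL2_sum => j js; apply/inL2Z/Lu/sub.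
have -> : (fun x => f x - \sum_(i <- i :: s) c i * u i x) =
  (fun x => (f x - \sum_(i <- s) c i * u i x) + (- c i) * u i x).
  by apply/funext => x; rewrite big_cons; ring.
rewrite L2innerDl //; last by apply/inL2Z/Lu.
rewrite L2innerZl //; last exact: Lu.
rewrite uh // mulr0 addr0 IH // => j js; [exact/Lu/sub|exact/uh/sub].
Qed.

(** The vectors are subtracted one at a time. By orthogonality the remaining coefficients of [f] do
    not change, so the completed squares add up. A common norm [M] is enough, as exponentials all
    have the same norm. *)
Lemma sqn_sub_sum (I : eqType) (s : seq I) (u : I -> T -> R[i])
    (c : I -> R[i]) f M :
  inL2 tau f -> uniq s -> {in s, forall i, inL2 tau (u i)} ->
  {in s, forall i, sqn (u i) = M} -> M != 0 ->
  {in s &, forall i j, i != j -> L2inner tau (u i) (u j) = 0} ->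
  sqn (fun x => f x - \sum_(i <- s) c i * u i x) =
  sqn f + (M * (\sum_(i <- s) normc (c i - L2inner tau f (u i) / M%:C) ^+ 2) -
    (\sum_(i <- s) normc (L2inner tau f (u i)) ^+ 2) / M).
Proof.
move=> Lf + + + M0; elim: s => [_ _ _ _|i s IH /= /andP[is_ us] Lu uM orth].
  rewrite !big_nil mulr0 mul0r subrr addr0; congr sqn; apply/funext => x.
  by rewrite big_nil subr0.
have ii : i \in i :: s by rewrite mem_head.
have sub j : j \in s -> j \in i :: s by rewrite in_cons orbC => ->.
have LS : inL2 tau (fun x => f x - \sum_(i <- s) c i * u i x).
  under eq_fun do rewrite -mulN1r; apply: inL2D => //; apply: inL2Z.
  by apply: inL2_sum => j js; apply/inL2Z/Lu/sub.
have -> : (fun x => f x - \sum_(i <- i :: s) c i * u i x) =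
  (fun x => (f x - \sum_(i <- s) c i * u i x) - c i * u i x).
  by apply/funext => x; rewrite big_cons; ring.
rewrite (sqn_sub1 _ LS _ (uM _ ii)) //; last exact: Lu.
have -> : L2inner tau (fun x => f x - \sum_(i <- s) c i * u i x) (u i) =
    L2inner tau f (u i).
  apply: L2inner_sub_orth => //; first exact: Lu.
    by move=> j js; exact/Lu/sub.
  by move=> j js; apply: orth (sub _ js) ii _; apply: contraNneq is_ => <-.
rewrite IH //.
- by rewrite !big_cons mulrDr mulrDl; lra.
- by move=> j js; exact/Lu/sub.
- by move=> j js; exact/uM/sub.
- by move=> j k js ks; apply: orth; exact: sub.
Qed.

(** With the Fourier coefficients the completed squares in [sqn_sub_sum] vanish, and what remains is
    a squared norm. *)
Lemma bessel (I : eqType) (s : seq I) (u : I -> T -> R[i]) f M :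
  inL2 tau f -> uniq s -> {in s, forall i, inL2 tau (u i)} ->
  {in s, forall i, sqn (u i) = M} -> 0 < M ->
  {in s &, forall i j, i != j -> L2inner tau (u i) (u j) = 0} ->
  \sum_(i <- s) normc (L2inner tau f (u i)) ^+ 2 <= M * sqn f.
Proof.
move=> Lf us Lu uM M0 orth.
have := sqn_sub_sum (fun i => L2inner tau f (u i) / M%:C) Lf us Lu uM (lt0r_neq0 M0) orth.
rewrite [X in M * X]big1 ?mulr0 ?add0r; last first.
  by move=> i _; rewrite subrr normc0 expr0n.
move=> e.
have := sqn_ge0 (fun x => f x - \sum_(i <- s) L2inner tau f (u i) / M%:C * u i x).
by rewrite e subr_ge0 ler_pdivrMr // mulrC.
Qed.

(* Best approximation: the Fourier coefficients minimise the distance. *)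
Lemma near_parseval (I : eqType) (s : seq I) (u : I -> T -> R[i])
    (c : I -> R[i]) f M (eps : R) :
  inL2 tau f -> uniq s -> {in s, forall i, inL2 tau (u i)} ->
  {in s, forall i, sqn (u i) = M} -> 0 < M ->
  {in s &, forall i j, i != j -> L2inner tau (u i) (u j) = 0} ->
  sqn (fun x => f x - \sum_(i <- s) c i * u i x) <= eps ->
  M * (sqn f - eps) <= \sum_(i <- s) normc (L2inner tau f (u i)) ^+ 2.
Proof.
move=> Lf us Lu uM M0 orth; rewrite (@sqn_sub_sum _ _ _ _ _ M) // ?lt0r_neq0 //.
set S1 := \sum_(i <- s) _; set S2 := \sum_(i <- s) _ => h.
have S1_ge0 : 0 <= M * S1.
  by rewrite mulr_ge0 ?(ltW M0) //; apply: sumr_ge0 => i _; exact: sqr_ge0.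
by rewrite mulrC -ler_pdivlMr //; lra.
Qed.

End ComplexIntegral.

(** * Product measures *)

Lemma EFin_Rintegral d (T : measurableType d) (R : realType)
    (m : {measure set T -> \bar R}) (h : T -> R) :
  m.-integrable setT (EFin \o h) ->
  (\int[m]_x (h x)%:E)%E = (\int[m]_x h x)%:E.
Proof. by move=> ih; rewrite /Rintegral fineK //; exact: integrable_fin_num. Qed.

Section RealTensor.
Context d1 d2 (T1 : measurableType d1) (T2 : measurableType d2) (R : realType).
Variables (mu : {finite_measure set T1 -> \bar R})
  (nu : {finite_measure set T2 -> \bar R}).
Variables (p : T1 -> R) (q : T2 -> R).
Hypotheses (ip : mu.-integrable setT (EFin \o p))
  (iq : nu.-integrable setT (EFin \o q)).

Let mpq : measurable_fun setT (fun z : T1 * T2 => (p z.1 * q z.2)%:E).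
Proof.
have mp : measurable_fun setT p by exact/measurable_EFinP/(measurable_int mu).
have mq : measurable_fun setT q by exact/measurable_EFinP/(measurable_int nu).
apply/measurable_EFinP/measurable_funM; exact: measurableT_comp.
Qed.

Lemma integrable_tensor : (mu \x nu)%E.-integrable setT
  (EFin \o (fun z : T1 * T2 => p z.1 * q z.2)).
Proof.
apply/integrable12ltyP => //=.
have iq' := integrable_norm iq; have ip' := integrable_norm ip.
under eq_integral => x _.
  under eq_integral => y _ do rewrite normrM.
  rewrite (EFin_Rintegral (integrableZlEFin _ iq')) RintegralZl // mulrC.
  over.
rewrite EFin_Rintegral ?ltry //.
exact: (integrableZlEFin _ ip').
Qed.

Lemma Rintegral_tensor : (\int[(mu \x nu)%E]_z (p z.1 * q z.2) =
  (\int[mu]_x p x) * (\int[nu]_y q y))%R.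
Proof.
apply: EFin_inj; rewrite -(EFin_Rintegral integrable_tensor).
rewrite -(integral12_prod_meas1 integrable_tensor) /fubini_F /=.
under eq_integral => x _.
  rewrite (EFin_Rintegral (integrableZlEFin _ iq)) RintegralZl // mulrC.
  over.
by rewrite (EFin_Rintegral (integrableZlEFin _ ip)) RintegralZl // mulrC.
Qed.

End RealTensor.

Section ComplexTensor.
Context d1 d2 (T1 : measurableType d1) (T2 : measurableType d2) (R : realType).
Variables (mu : {finite_measure set T1 -> \bar R})
  (nu : {finite_measure set T2 -> \bar R}).
Variables (f : T1 -> R[i]) (g : T2 -> R[i]).
Hypotheses (fi : cintegrable mu f) (gi : cintegrable nu g).

Lemma cintegrable_tensor :
  cintegrable (mu \x nu)%E (fun z : T1 * T2 => f z.1 * g z.2).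
Proof.
have [[f1 f2] [g1 g2]] := conj fi gi; split.
- apply: (eq_integrable measurableT _ _ _ (integrableB measurableT
    (integrable_tensor f1 g1) (integrable_tensor f2 g2))) => x _ /=.
  by rewrite cReM.
- apply: (eq_integrable measurableT _ _ _ (integrableD measurableT
    (integrable_tensor f1 g2) (integrable_tensor f2 g1))) => x _ /=.
  by rewrite cImM.
Qed.

Lemma cintegral_tensor : cintegral (mu \x nu)%E (fun z => f z.1 * g z.2) =
  cintegral mu f * cintegral nu g.
Proof.
have [[f1 f2] [g1 g2]] := conj fi gi; apply: complex_ext.
- rewrite cReM /= -!Rintegral_tensor // -RintegralB //;
    [|exact: (integrable_tensor f1 g1)|exact: (integrable_tensor f2 g2)].
  by apply: eq_Rintegral => x _; rewrite cReM.
- rewrite cImM /= -!Rintegral_tensor // -RintegralD //;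
    [|exact: (integrable_tensor f1 g2)|exact: (integrable_tensor f2 g1)].
  by apply: eq_Rintegral => x _; rewrite cImM.
Qed.

End ComplexTensor.

(** * Tensor products as functions on tuples *)

Section GluedTensor.
Context (R : realType) (m : nat).
Variables (mu : {finite_measure set (measurableTypeR R) -> \bar R})
  (nu : {finite_measure set (m.-tuple R) -> \bar R}).

Definition tensor (f : measurableTypeR R -> R[i]) (g : m.-tuple R -> R[i])
  (v : (1 + m).-tuple R) : R[i] := f (thead v) * g [tuple of behead v].

Lemma measurable_thead :
  measurable_fun setT (fun v : (1 + m).-tuple R => thead v : measurableTypeR R).
Proof. exact: measurable_tnth. Qed.

Lemma cmeasurable_comp d1 d2 (T1 : measurableType d1) (T2 : measurableType d2)
    (h : T1 -> T2) (f : T2 -> R[i]) :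
  measurable_fun setT h -> cmeasurable f -> cmeasurable (f \o h).
Proof.
by move=> mh [f1 f2]; split;
   [exact: (measurableT_comp f1 mh)|exact: (measurableT_comp f2 mh)].
Qed.

Lemma cmeasurable_tensor f g : cmeasurable f -> cmeasurable g ->
  cmeasurable (tensor f g).
Proof.
move=> mf mg; apply: cmeasurableM.
- exact: (cmeasurable_comp measurable_thead mf).
- exact: (cmeasurable_comp (@measurable_behead _ _ m) mg).
Qed.

Lemma tensor_glue f g z : tensor f g (Defs.glue z) = f z.1 * g z.2.
Proof.
by rewrite /tensor /Defs.glue theadE; congr (_ * g _); apply: val_inj.
Qed.

(** Change of variables, since [tuple_product] is an image measure. *)
Lemma cintegrable_glue (h : (1 + m).-tuple R -> R[i]) : cmeasurable h ->
  cintegrable (mu \x nu)%E (h \o @Defs.glue R m) ->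
  cintegrable (tuple_product mu nu) h /\
  cintegral (tuple_product mu nu) h = cintegral (mu \x nu)%E (h \o @Defs.glue R m).
Proof.
move=> [m1 m2] [i1 i2]; have mg := @measurable_glue R m.
have m1' : measurable_fun setT (EFin \o (fun x => complex.Re (h x))).
  exact/measurable_EFinP.
have m2' : measurable_fun setT (EFin \o (fun x => complex.Im (h x))).
  exact/measurable_EFinP.
split.
- split.
    exact: (integrable_pushforward mg m1' i1).
  exact: (integrable_pushforward mg m2' i2).
- rewrite /cintegral /Rintegral.
  by rewrite (integral_pushforward mg m1' i1) // (integral_pushforward mg m2' i2).
Qed.

Lemma cintegral_tuple_tensor f g : cmeasurable f -> cmeasurable g ->
  cintegrable mu f -> cintegrable nu g ->
  cintegrable (tuple_product mu nu) (tensor f g) /\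
  cintegral (tuple_product mu nu) (tensor f g) = cintegral mu f * cintegral nu g.
Proof.
move=> mf mg fi gi.
have e : tensor f g \o @Defs.glue R m = (fun z => f z.1 * g z.2).
  by apply/funext => z /=; rewrite tensor_glue.
have [] := cintegrable_glue (cmeasurable_tensor mf mg).
  by rewrite e; exact: cintegrable_tensor.
by rewrite e cintegral_tensor.
Qed.

(** The product of [f] with its conjugate is |f|^2; this reduces square integrability of a tensor to
    integrability of a tensor of products. *)
Lemma inL2_mul_conj d (T : measurableType d) (tau : {measure set T -> \bar R})
    (f : T -> R[i]) :
  cmeasurable f -> cintegrable tau (fun x => f x * (f x)^*) -> inL2 tau f.
Proof.
move=> mf [h _]; apply: inL2P => //.
apply: (eq_integrable measurableT _ _ _ h) => x _ /=; congr EFin.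
by rewrite cReM cRe_conj cIm_conj normc_sqr; ring.
Qed.

Lemma tensor_mul_conj f g f' g' v :
  tensor f g v * (tensor f' g' v)^* =
  tensor (fun x => f x * (f' x)^*) (fun y => g y * (g' y)^*) v.
Proof. by rewrite /tensor rmorphM /=; ring. Qed.

Lemma L2inner_tensor f g f' g' : inL2 mu f -> inL2 nu g ->
  inL2 mu f' -> inL2 nu g' ->
  L2inner (tuple_product mu nu) (tensor f g) (tensor f' g') =
  L2inner mu f f' * L2inner nu g g'.
Proof.
move=> Lf Lg Lf' Lg'; rewrite /L2inner.
under [X in cintegral _ X]eq_fun do rewrite tensor_mul_conj.
apply: (cintegral_tuple_tensor _ _ _ _).2.
- exact: (cmeasurableM Lf.1 (cmeasurable_conj Lf'.1)).
- exact: (cmeasurableM Lg.1 (cmeasurable_conj Lg'.1)).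
- exact: inL2_mul_integrable.
- exact: inL2_mul_integrable.
Qed.

Lemma inL2_tensor f g : inL2 mu f -> inL2 nu g ->
  inL2 (tuple_product mu nu) (tensor f g).
Proof.
move=> Lf Lg; apply: inL2_mul_conj; first exact: (cmeasurable_tensor Lf.1 Lg.1).
under [X in cintegrable _ X]eq_fun do rewrite tensor_mul_conj.
apply: (cintegral_tuple_tensor _ _ _ _).1.
- exact: (cmeasurableM Lf.1 (cmeasurable_conj Lf.1)).
- exact: (cmeasurableM Lg.1 (cmeasurable_conj Lg.1)).
- exact: inL2_mul_integrable.
- exact: inL2_mul_integrable.
Qed.

Lemma sqn_tensor f g : inL2 mu f -> inL2 nu g ->
  sqn (tuple_product mu nu) (tensor f g) = sqn mu f * sqn nu g.
Proof.
move=> Lf Lg; apply: complexI; rewrite rmorphM /= -!L2inner_id.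
by rewrite L2inner_tensor.
Qed.

End GluedTensor.

(** * Integrals of exponentials *)

Section Cis.
Variable R : realType.
Implicit Types x y t : R.

(** The character e(x) of the overview. By conversion [expo l y] is [cis (dotp l y)], which later
    rewrites exploit. *)
Definition cis x : R[i] := Complex (cos (2 * pi * x)) (sin (2 * pi * x)).

Lemma cisD x y : cis (x + y) = cis x * cis y.
Proof.
by apply: complex_ext; rewrite ?cReM ?cImM /= mulrDr ?cosD ?sinD //; ring.
Qed.

Lemma cis0 : cis 0 = 1.
Proof. by rewrite /cis mulr0 cos0 sin0. Qed.

Lemma cisN x : cis (- x) = (cis x)^*.
Proof. by rewrite /cis /= mulrN cosN sinN. Qed.

Lemma normc_cis x : normc (cis x) = 1.
Proof.
apply/eqP; rewrite -(@eqrXn2 _ 2) ?ler01 //; last exact: sqrtr_ge0.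
by rewrite normc_sqr /= cos2Dsin2 expr1n.
Qed.

Lemma cis_neq0 x : cis x != 0.
Proof.
apply/eqP => h; move: (normc_cis x); rewrite h normc0 => /esym/eqP.
by rewrite oner_eq0.
Qed.

Lemma cis_conj x : cis x * (cis x)^* = 1.
Proof. by rewrite -cisN -cisD subrr cis0. Qed.

Lemma cis_nat n : cis n%:R = 1.
Proof.
elim: n => [|n IH]; first exact: cis0.
rewrite -addn1 natrD cisD IH mul1r /cis mulr1.
by rewrite mulr_natl cos2pi sin2pi.
Qed.

Lemma cis_int (k : int) : cis k%:~R = 1.
Proof.
case: k => n; first exact: cis_nat.
by rewrite NegzE mulrNz cisN cis_nat conjc1.
Qed.

Lemma cisMn x n : cis (x * n%:R) = cis x ^+ n.
Proof.
elim: n => [|n IH]; first by rewrite mulr0 cis0.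
by rewrite -addn1 natrD mulrDr mulr1 cisD IH addn1 exprSr.
Qed.

(** Subtract the integer part. For 0 < y < 1 the real part of e(y) is 1 - 2 sin(pi y)^2, which is
    less than 1. *)
Lemma cis_eq1 x : cis x = 1 -> x = (Num.floor x)%:~R.
Proof.
move=> h; set k := Num.floor x.
have fx : cis (x - k%:~R) = 1 by rewrite cisD cisN cis_int conjc1 mulr1.
have y0 : 0 <= x - k%:~R by rewrite subr_ge0 floor_le.
have y1 : x - k%:~R < 1 by have := floorD1_gt x; rewrite -/k intrD; lra.
move: (x - k%:~R) y0 y1 fx (subrKC k%:~R x) => y.
rewrite le_eqVlt => /predU1P[<- _ _ <-|y0 y1 [+ _] _]; first by rewrite addr0.
have -> : 2 * pi * y = (pi * y) *+ 2 by ring.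
rewrite cos_mulr2n cos2sin2 => h1.
have s0 : 0 < sin (pi * y).
  by apply: sin_gt0_pi; rewrite mulr_gt0 ?pi_gt0 //= gtr_pMr // pi_gt0.
have := exprn_gt0 2 s0; lra.
Qed.

Definition wave t : measurableTypeR R -> R[i] := fun x => cis (t * x).

Lemma waveD s t x : wave (s + t) x = wave s x * wave t x.
Proof. by rewrite /wave mulrDl cisD. Qed.

Lemma wave_conj t x : (wave t x)^* = wave (- t) x.
Proof. by rewrite /wave mulNr cisN. Qed.

Lemma wave0 x : wave 0 x = 1.
Proof. by rewrite /wave mul0r cis0. Qed.

Lemma cmeasurable_wave t : cmeasurable (wave t).
Proof.
split; apply: continuous_measurable_fun => x; rewrite /wave /cis /=.
- apply: continuous_comp; last exact: continuous_cos.
  by do 2!apply: cvgMl_tmp; exact: cvg_id.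
- apply: continuous_comp; last exact: continuous_sin.
  by do 2!apply: cvgMl_tmp; exact: cvg_id.
Qed.

End Cis.

Section IntervalIntegrals.
Variable R : realType.
Implicit Types (a b c t : R).
Local Notation leb := (@lebesgue_measure R).

Lemma Rintegral_FTC (f F : R -> R) a b : a < b -> continuous f ->
  (forall x : R, is_derive x 1 F (f x)) ->
  \int[leb]_(x in `[a, b]) f x = F b - F a.
Proof.
move=> ab cf dF.
have cF : continuous F.
  move=> x; apply: differentiable_continuous; apply/derivable1_diffP.
  exact: (@ex_derive _ _ _ _ _ _ _ (dF x)).
rewrite /Rintegral (@continuous_FTC2 _ f F a b) //.
- exact: continuous_subspaceT.
- split.
  + by move=> x _; exact: (@ex_derive _ _ _ _ _ _ _ (dF x)).
  + by apply: cvg_at_right_filter; exact: cF.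
  + by apply: cvg_at_left_filter; exact: cF.
- by move=> x _; rewrite derive1E; exact: (@derive_val _ _ _ _ _ _ _ (dF x)).
Qed.

Lemma continuous_scale (f : R -> R) c : continuous f -> continuous (fun x => f (c * x)).
Proof.
move=> cf x; apply: (@continuous_comp _ _ _ (fun x => c * x) f); last exact: cf.
by apply: cvgMl_tmp; exact: cvg_id.
Qed.

Lemma is_derive_scale (f : R -> R) c x df : is_derive (c * x) 1 f df ->
  is_derive x 1 (fun x => f (c * x)) (df * c).
Proof.
move=> dF.
have ds : is_derive x (1 : R) (fun x : R => c * x) c.
  by apply: is_derive_eq; rewrite ?scaler0 ?addr0 /GRing.scale /= ?mulr1.
exact: is_derive1_comp.
Qed.

Lemma Rintegral_cos c a b : c != 0 -> a < b ->
  \int[leb]_(x in `[a, b]) cos (c * x) = (sin (c * b) - sin (c * a)) / c.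
Proof.
move=> c0 ab.
have dF x : is_derive (x : R) 1 (fun x => c^-1 * sin (c * x)) (cos (c * x)).
  have ds := is_derive_scale (is_derive_sin (c * x)).
  by apply: is_derive_eq; rewrite ?scaler0 ?addr0 /GRing.scale /=; field.
rewrite (Rintegral_FTC ab _ dF); last exact/continuous_scale/continuous_cos.
by rewrite -mulrBr mulrC.
Qed.

Lemma Rintegral_sin c a b : c != 0 -> a < b ->
  \int[leb]_(x in `[a, b]) sin (c * x) = (cos (c * a) - cos (c * b)) / c.
Proof.
move=> c0 ab.
have dF x : is_derive (x : R) 1 (fun x => - c^-1 * cos (c * x)) (sin (c * x)).
  have ds := is_derive_scale (is_derive_cos (c * x)).
  by apply: is_derive_eq; rewrite ?scaler0 ?addr0 /GRing.scale /=; field.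
rewrite (Rintegral_FTC ab _ dF); last exact/continuous_scale/continuous_sin.
by field.
Qed.

End IntervalIntegrals.

(** * Integration against restricted Lebesgue measure *)

Section RestrictedLebesgue.
Variable R : realType.
Local Notation leb := (@lebesgue_measure R).
Implicit Types (h : measurableTypeR R -> R) (D : set (measurableTypeR R)).

(** The complement of [D] is null for the restricted measure, and the two measures agree on subsets
    of [D]. *)
Lemma Rintegral_mrestr D (mD : measurable D) h :
  (mrestr leb mD).-integrable setT (EFin \o h) ->
  \int[mrestr leb mD]_x h x = \int[leb]_(x in D) h x.
Proof.
move=> ih; rewrite /Rintegral; congr fine.
rewrite (@negligible_integral _ _ _ (mrestr leb mD) setT (~` D)) //.
- rewrite setTD setCK; apply: eq_measure_integral => A mA AD.
  by rewrite /= /mrestr setIidl.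
- exact: measurableC.
- by rewrite /= /mrestr setICl measure0.
Qed.

Lemma fin_num_mrestr D (mD : measurable D) : (leb D < +oo)%E ->
  fin_num_fun (mrestr leb mD).
Proof.
move=> Dfin A mA; rewrite ge0_fin_numE; last exact: measure_ge0.
rewrite /mrestr (le_lt_trans _ Dfin) //.
by apply: le_measure; rewrite ?inE //; exact: measurableI.
Qed.

Lemma bounded_integrable d (T : measurableType d) (m : {measure set T -> \bar R})
    (h : T -> R) (A : set T) :
  measurable A -> (m A < +oo)%E -> measurable_fun setT h ->
  (forall x, `|h x| <= 1) -> m.-integrable A (EFin \o h).
Proof.
move=> mA mfin mh bh; apply: measurable_bounded_integrable => //.
  exact: measurable_funS mh.
exists 1; split=> // M M1 x _ /=.
by apply: (le_trans (bh x)); exact: ltW.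
Qed.

Lemma lebesgue_itv_lty (a b : R) : (leb `[a, b]%classic < +oo)%E.
Proof. by rewrite /= lebesgue_measure_itv /=; case: ifP => // _; rewrite -EFinB ltry. Qed.

Lemma Rintegral_unit_split h N : measurable_fun setT h -> (forall x, `|h x| <= 1) ->
  \int[leb]_(x in `[0, N%:R]) h x =
  \sum_(0 <= n < N) \int[leb]_(x in `[n%:R, n.+1%:R]) h x.
Proof.
move=> mh bh.
have ih a b : leb.-integrable `[a, b]%classic (EFin \o h).
  by apply: bounded_integrable => //; exact: lebesgue_itv_lty.
elim: N => [|N IH]; first by rewrite big_geq // set_itv1 Rintegral_set1.
rewrite big_nat_recr //= -IH; apply/eqP; rewrite -subr_eq addrC; apply/eqP.
rewrite -Rintegral_itv_obnd_cbnd; last first.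
  by apply: integrableS (ih N%:R N.+1%:R) => //; exact: subset_itv_oc_cc.
rewrite -(@Rintegral_itvB _ _ (BLeft 0) (BRight N.+1%:R) N%:R)
  ?bnd_simp ?ler_nat ?ler0n //.
by rewrite addrC subKr.
Qed.

Lemma plus_unit_sub (A : set nat) N : (forall n, A n -> (n < N)%N) ->
  @plus_unit R A `<=` `[0, N%:R].
Proof.
move=> AN x [a Aa [t]]; rewrite /= !in_itv /= => /andP[t0 t1] <-.
rewrite addr_ge0 //=; apply: (@le_trans _ _ (a.+1%:R)).
  by rewrite -natr1 lerD2l.
by rewrite ler_nat AN.
Qed.

(** The interval is open because an integer endpoint may belong to A + [0,1] through the
    neighbouring unit interval. *)
Lemma plus_unit_oo (A : set nat) n x :
  x \in `]n%:R, n.+1%:R[ -> (x \in @plus_unit R A) = (n \in A).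
Proof.
rewrite in_itv /= => /andP[nx xn].
apply/idP/idP; rewrite !inE.
- move=> [a Aa [t]]; rewrite /= in_itv /= => /andP[t0 t1] e.
  suff -> : n = a by [].
  have na : (n < a.+1)%N by rewrite -(ltr_nat R) -natr1; lra.
  have an : (a < n.+1)%N by rewrite -(ltr_nat R); lra.
  by apply/eqP; rewrite eqn_leq -ltnS na -ltnS an.
- move=> An; exists n => //; exists (x - n%:R); last by rewrite addrC subrK.
  by rewrite /= in_itv /=; move: xn; rewrite -natr1 => xn; apply/andP; split; lra.
Qed.

Lemma Rintegral_plus_unit (A : set nat) N h : (forall n, A n -> (n < N)%N) ->
  measurable_fun setT h -> (forall x, `|h x| <= 1) ->
  \int[lebesgue_on_plus_unit R A]_x h x =
  \sum_(0 <= n < N | n \in A) \int[leb]_(x in `[n%:R, n.+1%:R]) h x.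
Proof.
move=> AN mh bh.
have mO := @measurable_plus_unit R A.
have sub := plus_unit_sub AN.
have Ofin : (leb (@plus_unit R A) < +oo)%E.
  apply: le_lt_trans (lebesgue_itv_lty 0 N%:R).
  by apply: le_measure; rewrite ?inE.
rewrite Rintegral_mrestr; last first.
  apply: bounded_integrable => //.
  by rewrite /= /mrestr setTI.
(* Extension by zero turns the integral over A + [0,1] into one over [0, N], which splits at the
   integers. *)
pose k := h \_ (@plus_unit R A).
have mk : measurable_fun setT k.
  by apply/(measurable_restrict _ mO measurableT); rewrite setTI;
     exact: measurable_funS mh.
have bk x : `|k x| <= 1.
  by rewrite /k patchE; case: ifP => // _; rewrite normr0.
rewrite -[X in \int[leb]_(x in X) _](setIidr sub) Rintegral_mkcondr.
rewrite -/k Rintegral_unit_split // [RHS]big_mkcond; apply: eq_bigr => n _.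
have ik : leb.-integrable `[n%:R, n.+1%:R]%classic (EFin \o k).
  by apply: bounded_integrable => //; exact: lebesgue_itv_lty.
have ih : leb.-integrable `[n%:R, n.+1%:R]%classic (EFin \o h).
  by apply: bounded_integrable => //; exact: lebesgue_itv_lty.
(* Endpoints are null, so each unit interval may be replaced by its interior, where membership in A
   + [0,1] is constant. *)
have oo (g : measurableTypeR R -> R) :
    leb.-integrable `[n%:R, n.+1%:R]%classic (EFin \o g) ->
    \int[leb]_(x in `[n%:R, n.+1%:R]) g x = \int[leb]_(x in `]n%:R, n.+1%:R[) g x.
  move=> ig; rewrite -Rintegral_itv_bndo_bndc; last first.
    by apply: integrableS ig => //; exact: subset_itv_co_cc.
  rewrite -Rintegral_itv_obnd_cbnd //.
  by apply: integrableS ig => //; exact: subset_itv_oo_cc.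
rewrite (oo _ ik) (oo _ ih).
case: ifPn => nA.
- apply: eq_Rintegral => x /set_mem /= xn.
  by rewrite /k patchE (@plus_unit_oo A n x xn) nA.
- rewrite (@eq_Rintegral _ _ _ _ _ (fun=> 0)); first by rewrite Rintegral_cst ?mul0r.
  move=> x /set_mem /= xn.
  by rewrite /k patchE (@plus_unit_oo A n x xn) (negbTE nA).
Qed.

End RestrictedLebesgue.

Lemma inL2_bounded d (T : measurableType d) (R : realType)
    (tau : {measure set T -> \bar R}) (f : T -> R[i]) :
  fin_num_fun tau -> cmeasurable f -> (forall x, normc (f x) ^+ 2 <= 1) ->
  inL2 tau f.
Proof.
move=> tau_fin mf bf; apply: inL2P => //; apply: bounded_integrable => //.
- by have := tau_fin _ measurableT; rewrite ge0_fin_numE.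
- exact: measurable_normc_sqr.
- by move=> x; rewrite ger0_norm // sqr_ge0.
Qed.

(** * Fourier integrals over intervals *)

Section WaveIntegrals.
Variable R : realType.
Implicit Types (a b c t : R).
Local Notation leb := (@lebesgue_measure R).

Definition wave_integral a b t : R[i] :=
  Complex (\int[leb]_(x in `[a, b]) complex.Re (wave t x))
          (\int[leb]_(x in `[a, b]) complex.Im (wave t x)).

(** The factor 2 pi i t from integrating e(tx) stays on the left, which avoids complex division. *)
Lemma wave_integralE a b t : t != 0 -> a < b ->
  Complex 0 (2 * pi * t) * wave_integral a b t = cis (t * b) - cis (t * a).
Proof.
move=> t0 ab.
have c0 : 2 * pi * t != 0 by rewrite mulf_neq0 // mulf_neq0 // lt0r_neq0 // pi_gt0.
have eR : \int[leb]_(x in `[a, b]) complex.Re (wave t x) =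
    (sin (2 * pi * t * b) - sin (2 * pi * t * a)) / (2 * pi * t).
  by rewrite -Rintegral_cos //; apply: eq_Rintegral => x _; rewrite /= !mulrA.
have eI : \int[leb]_(x in `[a, b]) complex.Im (wave t x) =
    (cos (2 * pi * t * a) - cos (2 * pi * t * b)) / (2 * pi * t).
  by rewrite -Rintegral_sin //; apply: eq_Rintegral => x _; rewrite /= !mulrA.
rewrite /wave_integral eR eI; apply: complex_ext; rewrite ?cReM ?cImM /= !mulrA.
- by move: c0; set c := 2 * pi * t => c0; field.
- by move: c0; set c := 2 * pi * t => c0; field.
Qed.

Lemma wave_integral0 a b : a <= b -> wave_integral a b 0 = (b - a)%:C.
Proof.
move=> ab; rewrite /wave_integral (_ : wave 0 = fun=> 1); last first.
  by apply/funext => x; rewrite wave0.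
apply: complex_ext; rewrite /= Rintegral_cst // ?mul0r // mul1r.
rewrite /= lebesgue_measure_itv /= lte_fin.
by case: ltgtP ab => // -> _; rewrite subrr.
Qed.

Lemma wave_integral_conj a b t :
  wave_integral a b (- t) = (wave_integral a b t)^*.
Proof.
rewrite /wave_integral (_ : wave (- t) = fun x => (wave t x)^*); last first.
  by apply/funext => x; rewrite wave_conj.
congr Complex; rewrite -mulN1r -RintegralZl //.
  by apply: eq_Rintegral => x _; rewrite cIm_conj mulN1r.
apply: bounded_integrable => //; first exact: lebesgue_itv_lty.
  by case: (cmeasurable_wave t).
by move=> x; rewrite sin_max.
Qed.

Lemma Re_wave_le1 t x : `|complex.Re (wave t x)| <= 1.
Proof. exact: cos_max. Qed.

Lemma Im_wave_le1 t x : `|complex.Im (wave t x)| <= 1.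
Proof. exact: sin_max. Qed.

Section FiniteMeasure.
Variable mu : {measure set (measurableTypeR R) -> \bar R}.
Hypothesis mu_fin : fin_num_fun mu.

Lemma inL2_wave t : inL2 mu (wave t).
Proof.
apply: inL2_bounded => //; first exact: cmeasurable_wave.
by move=> x; rewrite normc_cis expr1n.
Qed.

Lemma L2inner_wave s t : L2inner mu (wave s) (wave t) = cintegral mu (wave (s - t)).
Proof.
by congr cintegral; apply/funext => x; rewrite wave_conj -waveD.
Qed.

Lemma sqn_wave t : (sqn mu (wave t))%:C = cintegral mu (wave 0).
Proof. by rewrite -L2inner_id L2inner_wave subrr. Qed.

End FiniteMeasure.

(** The modulated indicator f e(tx) of the overview; modulation translates its Fourier
    coefficients. *)
Definition window b t : measurableTypeR R -> R[i] :=
  fun x => (\1_(`[0, b]%classic : set R) x)%:C * wave t x.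

Lemma cmeasurable_window b t : cmeasurable (window b t).
Proof.
apply: cmeasurableM; last exact: cmeasurable_wave.
by split => /=; [exact: measurable_indic|exact: measurable_cst].
Qed.

Lemma normc_window_le1 b t x : normc (window b t x) ^+ 2 <= 1.
Proof.
rewrite /window normcM normc_cis mulr1 normc_sqr /= expr0n addr0 indicE.
by case: (_ \in _); rewrite ?expr1n ?expr0n.
Qed.

Lemma inL2_window (mu : {measure set (measurableTypeR R) -> \bar R}) b t :
  fin_num_fun mu -> inL2 mu (window b t).
Proof.
move=> mu_fin; apply: inL2_bounded => //; first exact: cmeasurable_window.
exact: normc_window_le1.
Qed.

Lemma cintegral_window (D : set (measurableTypeR R)) (mD : measurable D) b t :
  (leb D < +oo)%E -> `[0, b] `<=` D ->
  cintegral (mrestr leb mD) (window b t) = wave_integral 0 b t.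
Proof.
move=> Dfin KD; have [mr mi] := cmeasurable_window b t.
have rfin : (mrestr leb mD setT < +oo)%E by rewrite /= /mrestr setTI.
have le1 (x y : R) : x ^+ 2 + y ^+ 2 <= 1 -> `|x| <= 1.
  move=> h; rewrite -(@ler_pXn2r _ 2) ?nnegrE // expr1n real_normK ?num_real //.
  by have := sqr_ge0 y; lra.
rewrite /cintegral /wave_integral; congr Complex.
- rewrite Rintegral_mrestr; last first.
    apply: bounded_integrable => // x.
    by have := normc_window_le1 b t x; rewrite normc_sqr; exact: le1.
  rewrite -[in RHS](setIidr KD) Rintegral_mkcondr.
  apply: eq_Rintegral => x _; rewrite patchE /window cReM /= mul0r subr0 indicE.
  by case: ifP; rewrite ?mul1r ?mul0r.
- rewrite Rintegral_mrestr; last first.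
    apply: bounded_integrable => // x.
    by have := normc_window_le1 b t x; rewrite normc_sqr addrC; exact: le1.
  rewrite -[in RHS](setIidr KD) Rintegral_mkcondr.
  apply: eq_Rintegral => x _; rewrite patchE /window cImM /= mul0r addr0 indicE.
  by case: ifP; rewrite ?mul1r ?mul0r.
Qed.

Lemma window_conj_wave b s t x : window b s x * (wave t x)^* = window b (s - t) x.
Proof. by rewrite /window wave_conj -mulrA -waveD. Qed.

Lemma window_conj b s x : window b s x * (window b s x)^* = window b 0 x.
Proof.
rewrite /window indicE; case: (_ \in _); last by rewrite rmorph0 !mul0r.
by rewrite rmorph1 !mul1r wave_conj -waveD subrr.
Qed.

Lemma L2inner_window (D : set (measurableTypeR R)) (mD : measurable D) b s t :
  (leb D < +oo)%E -> `[0, b] `<=` D ->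
  L2inner (mrestr leb mD) (window b s) (wave t) = wave_integral 0 b (s - t).
Proof.
move=> Dfin KD; rewrite -(cintegral_window mD) //.
by congr cintegral; apply/funext => x; rewrite window_conj_wave.
Qed.

Lemma sqn_window (D : set (measurableTypeR R)) (mD : measurable D) b s :
  (leb D < +oo)%E -> 0 <= b -> `[0, b] `<=` D ->
  sqn (mrestr leb mD) (window b s) = b.
Proof.
move=> Dfin b0 KD; apply: complexI; rewrite -L2inner_id.
transitivity (cintegral (mrestr leb mD) (window b 0)).
  by congr cintegral; apply/funext => x; rewrite window_conj.
by rewrite cintegral_window // wave_integral0 // subr0.
Qed.

Lemma wave_integral_unity (N : nat) t : (0 < N)%N -> t != 0 -> cis (t * N%:R) = 1 ->
  wave_integral 0 N%:R t = 0.
Proof.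
move=> N0 t0 h; have := wave_integralE t0 (a := 0) (b := N%:R).
rewrite ltr0n N0 h mulr0 cis0 subrr => /(_ isT)/eqP.
rewrite mulf_eq0 => /orP[|/eqP //]; rewrite eq_complex /= eqxx /=.
by rewrite !mulf_eq0 (negbTE t0) !gt_eqF ?pi_gt0.
Qed.

(** Waves whose frequencies differ by multiples of 1/N are orthogonal on [0, N] with squared norm N,
    and the indicator of [0, b] has squared norm [b]; Bessel's inequality gives the bound. *)
Lemma bessel_window (N : nat) b (s : seq R) : (0 < N)%N -> 0 <= b <= N%:R ->
  uniq s -> {in s &, forall t t', cis ((t - t') * N%:R) = 1} ->
  \sum_(t <- s) normc (wave_integral 0 b t) ^+ 2 <= N%:R * b.
Proof.
move=> N0 /andP[b0 bN] us hs.
pose D : set (measurableTypeR R) := `[0, N%:R]%classic.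
have mD : measurable D by exact: measurable_itv.
have Dfin : (leb D < +oo)%E by exact: lebesgue_itv_lty.
have KD : `[0, b] `<=` D by move=> x; apply: subset_itvl; rewrite bnd_simp.
have fm := fin_num_mrestr mD Dfin.
have rfin : (mrestr leb mD setT < +oo)%E by rewrite /= /mrestr setTI.
have N_wave u : cintegral (mrestr leb mD) (wave u) = wave_integral 0 N%:R u.
  have [mr mi] := cmeasurable_wave u.
  rewrite /cintegral /wave_integral !Rintegral_mrestr //.
  - by apply: bounded_integrable => // x; exact: Im_wave_le1.
  - by apply: bounded_integrable => // x; exact: Re_wave_le1.
have eNt t : wave_integral 0 b t = (L2inner (mrestr leb mD) (window b 0) (wave t))^*.
  by rewrite L2inner_window // sub0r wave_integral_conj conjcK.
under eq_bigr do rewrite eNt normc_conj.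
rewrite -[X in _ <= _ * X](sqn_window mD 0) //.
apply: (bessel (inL2_window b 0 fm) us).
- by move=> t _; exact: inL2_wave.
- move=> t _; apply: complexI.
  by rewrite sqn_wave // N_wave wave_integral0 // subr0.
- by rewrite ltr0n.
- move=> t t' ts t's tt'; rewrite L2inner_wave N_wave.
  apply: wave_integral_unity => //; last exact: hs.
  by rewrite subr_eq0.
Qed.

(** The length 1/(2 pi) keeps the angle 2 pi t x within [0, 1], where the cosine is at least cos 1 >
    0. Hence already the real part is bounded below. *)
Lemma wave_integral_lower t : 0 <= t <= 1 ->
  ((2 * pi)^-1 * cos 1) ^+ 2 <= normc (wave_integral 0 (2 * pi)^-1 t) ^+ 2 :> R.
Proof.
move=> /andP[t0 t1]; have pi0 : 0 < pi :> R := pi_gt0 R.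
have b0 : 0 < (2 * pi)^-1 :> R by rewrite invr_gt0 mulr_gt0.
have cos1 : 0 < cos 1 :> R := cos1_gt0 R.
rewrite normc_sqr; set re := complex.Re _.
suff h : (2 * pi)^-1 * cos 1 <= re.
  apply: (@le_trans _ _ (re ^+ 2)); last by rewrite lerDl sqr_ge0.
  by rewrite lerXn2r // nnegrE ?mulr_ge0 ?ltW // (lt_le_trans _ h) // mulr_gt0.
rewrite /re /wave_integral /= mulrC.
have -> : cos 1 * (2 * pi)^-1 = \int[leb]_(x in `[0, (2 * pi)^-1]) cos 1 :> R.
  by rewrite Rintegral_cst //= lebesgue_measure_itv /= lte_fin b0 /= oppr0 addr0.
have [mr _] := cmeasurable_wave t.
apply: le_Rintegral => //.
- apply: measurable_bounded_integrable => //; first exact: lebesgue_itv_lty.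
  exists 1; split=> // M M1 x _ /=; apply: (le_trans (cos_max 1)); exact: ltW.
- by apply: bounded_integrable => //; [exact: lebesgue_itv_lty|exact: Re_wave_le1].
- move=> x /=; rewrite in_itv /= => /andP[x0 xb].
  have pi2 : 1 <= pi :> R by apply: le_trans (pi_ge2 R); lra.
  have z0 : 0 <= 2 * pi * (t * x) by rewrite !mulr_ge0 // ltW.
  have z1 : 2 * pi * (t * x) <= 1.
    rewrite mulrC -ler_pdivlMr ?mulr_gt0 // mul1r (le_trans _ xb) //.
    by rewrite -[leRHS]mul1r ler_wpM2r.
  move: z1; rewrite le_eqVlt => /predU1P[->//|z1].
  by apply/ltW; rewrite ltr_cos // in_itv /= ?z0 ?ler01 //= (le_trans (ltW z1)).
Qed.

End WaveIntegrals.

(** * The transform of Lebesgue measure on A + [0,1] *)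

Section PlusUnitTransform.
Variables (R : realType) (N : nat) (A B : set nat).
Hypotheses (N0 : (0 < N)%N) (AB : complementary_pair N A B).
Local Notation mu := (lebesgue_on_plus_unit R A).
Local Notation hat t := (cintegral mu (wave t)).

Lemma complementary_tiles : tiles N (fun n => n \in A) (fun n => n \in B).
Proof.
have [sumE uniq] := AB; split.
- move=> a b /set_mem Aa /set_mem Bb.
  suff : [set (a + b)%N | a in A & b in B] (a + b)%N by rewrite sumE.
  by exists a => //; exists b.
- move=> n nN; have : [set (a + b)%N | a in A & b in B] n by rewrite sumE.
  by move=> [a Aa [b Bb <-]]; exists a, b; rewrite !inE.
- move=> a b a' b' /set_mem Aa /set_mem Bb /set_mem Aa' /set_mem Bb' e.
  have abN : (a + b < N)%N.
    suff : [set (a + b)%N | a in A & b in B] (a + b)%N by rewrite sumE.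
    by exists a => //; exists b.
  have [q [_ qu]] := uniq _ abN.
  have e1 := qu (a, b) (And3 Aa Bb erefl).
  have e2 := qu (a', b') (And3 Aa' Bb' (esym e)).
  by have [] : (a, b) = (a', b') by rewrite -e1 -e2.
Qed.

Lemma complementary_lt n : A n -> (n < N)%N.
Proof.
have [lt _ _] := complementary_tiles; have [_ B0] := tiles0 N0 complementary_tiles.
by move=> An; have := lt n 0%N; rewrite addn0; apply => //; exact/mem_set.
Qed.

Lemma plus_unit_lty : (@lebesgue_measure R (@plus_unit R A) < +oo)%E.
Proof.
apply: le_lt_trans (lebesgue_itv_lty 0 N%:R).
apply: le_measure; rewrite ?inE //.
  exact: measurable_plus_unit.
exact/plus_unit_sub/complementary_lt.
Qed.

Lemma fin_num_plus_unit : fin_num_fun mu.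
Proof. exact: fin_num_mrestr plus_unit_lty. Qed.

Lemma plus_unit_01 (b : R) : b <= 1 -> `[0, b] `<=` @plus_unit R A.
Proof.
have [/set_mem A0 _] := tiles0 N0 complementary_tiles.
move=> b1 x /=; rewrite in_itv /= => /andP[x0 xb]; exists 0%N => //; exists x.
  by rewrite /= in_itv /= x0 (le_trans xb).
by rewrite add0r.
Qed.

Lemma transformE t :
  hat t = \sum_(0 <= n < N | n \in A) wave_integral n%:R n.+1%:R t.
Proof.
have [mr mi] := cmeasurable_wave t; have AN := complementary_lt.
apply: complex_ext.
- rewrite (big_morph _ (@cReD R) erefl) /=.
  by apply: Rintegral_plus_unit => // x; exact: Re_wave_le1.
- rewrite (big_morph _ (@cImD R) erefl) /=.
  by apply: Rintegral_plus_unit => // x; exact: Im_wave_le1.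
Qed.

Lemma transform0 : hat 0 = gensum N (fun n => n \in A) 1.
Proof.
rewrite transformE; apply: eq_bigr => n _.
by rewrite wave_integral0 ?ler_nat // expr1n -natr1 addrAC subrr add0r.
Qed.

(** The unit interval at [n] contributes e(t)^(n + 1) - e(t)^n once 2 pi i t is cleared. *)
Lemma transform_geom t : t != 0 ->
  Complex 0 (2 * pi * t) * hat t =
  (cis t - 1) * gensum N (fun n => n \in A) (cis t).
Proof.
move=> t0; rewrite transformE !mulr_sumr; apply: eq_bigr => n _.
rewrite wave_integralE ?ltr_nat // !cisMn exprSr; ring.
Qed.

Lemma transform_eq0 t : t != 0 -> hat t = 0 ->
  cis t = 1 \/ gensum N (fun n => n \in A) (cis t) = 0.
Proof.
move=> /transform_geom e h; move: e; rewrite h mulr0 => /esym/eqP.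
by rewrite mulf_eq0 subr_eq0 => /orP[]/eqP; [left|right].
Qed.

Lemma transform_zeros t : t != 0 -> hat t = 0 -> cis (t * N%:R) = 1.
Proof.
move=> t0 /(transform_eq0 t0)[h|h]; rewrite cisMn; first by rewrite h expr1n.
exact: (gensum_eq0 N0 complementary_tiles).
Qed.

Lemma cis_primitive : N.-primitive_root (cis (N%:R^-1) : R[i]).
Proof.
have N0' : N%:R != 0 :> R by rewrite pnatr_eq0 -lt0n.
have zN : cis (N%:R^-1) ^+ N = 1 :> R[i].
  by rewrite -cisMn mulVf // -[1]/(1%:R) cis_nat.
have [k pk kN] := prim_order_exists N0 zN.
suff e : k = N by move: pk; rewrite e.
apply/eqP; rewrite eqn_leq dvdn_leq //=.
have k0 := prim_order_gt0 pk.
(* The order [k] divides N, and e(k/N) = 1 makes k/N a positive integer, so N <= k. *)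
have := prim_expr_order pk; rewrite -cisMn => /cis_eq1.
set j := Num.floor _ => e.
have e' : k%:R = j%:~R * N%:R :> R by rewrite -e mulrAC mulVf // mul1r.
have j1 : 1 <= (j%:~R : R).
  rewrite -[1]/(1%:~R) ler_int -gtz0_ge1 -(ltr0z R).
  by rewrite -e mulr_gt0 ?invr_gt0 ?ltr0n.
by rewrite -(ler_nat R) e' ler_peMl.
Qed.

Lemma nonvanishing_set : exists S : seq nat, [/\ uniq S,
  (size S)%:R * hat 0 = N%:R &
  {in S &, forall s s', hat ((s%:R - s'%:R) / N%:R) != 0}].
Proof.
have N0' : N%:R != 0 :> R by rewrite pnatr_eq0 -lt0n.
have [S [uS ltS cS nzS]] := tiles_nonvanishing R[i] N0 complementary_tiles.
exists S; split=> //; first by rewrite transform0.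
(* The diagonal case is included: it serves for two points of the spectrum with the same first
   coordinate. *)
move=> s s' sS s'S; have [<-|ss'] := eqVneq s s'.
  rewrite subrr mul0r transform0; apply/eqP => h; move: cS; rewrite h mulr0.
  by move/esym/eqP; rewrite pnatr_eq0 -leqn0 leqNgt N0.
have ec : cis ((s%:R - s'%:R) / N%:R) = cis N%:R^-1 ^+ s / cis N%:R^-1 ^+ s' :> R[i].
  rewrite mulrBl cisD cisN ![_%:R / N%:R]mulrC !cisMn; congr (_ * _).
  apply: (mulfI (x := cis N%:R^-1 ^+ s')); first by rewrite expf_neq0 // cis_neq0.
  by rewrite divff ?expf_neq0 ?cis_neq0 // -cisMn cis_conj.
apply/eqP => /transform_eq0[].
- by rewrite mulf_neq0 ?invr_eq0 // subr_eq0 eqr_nat.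
- rewrite ec => /divr1_eq /eqP; rewrite (eq_prim_root_expr cis_primitive).
  by rewrite !modn_small ?(allP ltS) //; exact/negP.
- by apply/eqP; rewrite ec; exact: (nzS _ cis_primitive).
Qed.

End PlusUnitTransform.

(** * From a spectrum of the product to a spectrum of the factor *)

Section Exponentials.
Variables (R : realType) (m : nat).
Implicit Types l y : m.-tuple R.

Lemma cmeasurable_expo l : cmeasurable (expo l).
Proof.
have mdot : measurable_fun setT (fun y => 2 * pi * dotp l y).
  apply: measurable_funM; first exact: measurable_cst.
  apply: measurable_sum => i; apply: measurable_funM; first exact: measurable_cst.
  exact: measurable_tnth.
split.
- exact: (measurableT_comp (continuous_measurable_fun (@continuous_cos R)) mdot).
- exact: (measurableT_comp (continuous_measurable_fun (@continuous_sin R)) mdot).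
Qed.

Lemma inL2_expo (nu : {measure set (m.-tuple R) -> \bar R}) l :
  fin_num_fun nu -> inL2 nu (expo l).
Proof.
move=> nu_fin; apply: inL2_bounded => //; first exact: cmeasurable_expo.
by move=> y; rewrite -[expo l y]/(cis (dotp l y)) normc_cis expr1n.
Qed.

Lemma sqn_expo (nu : {measure set (m.-tuple R) -> \bar R}) l :
  sqn nu (expo l) = fine (nu setT).
Proof.
rewrite /sqn /L2sqnorm; congr fine.
under eq_integral do rewrite -[expo l _]/(cis (dotp l _)) normc_cis expr1n.
by rewrite integral_cst // mul1e.
Qed.

Lemma expo_tensor (x : (1 + m).-tuple R) :
  expo x = tensor (wave (thead x)) (expo [tuple of behead x]).
Proof.
apply/funext => v; rewrite /tensor /wave -[expo _ v]/(cis (dotp x v)).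
rewrite -[expo _ _]/(cis (dotp _ _)) -cisD /dotp big_ord_recl; congr (cis (_ + _)).
apply: eq_bigr => i _.
by rewrite {1}(tuple_eta x) {1}(tuple_eta v) !tnthS.
Qed.

End Exponentials.

Section Descent.
Variables (R : realType) (m N : nat) (S : seq nat).
Variables (mu : {finite_measure set (measurableTypeR R) -> \bar R})
  (nu : {finite_measure set (m.-tuple R) -> \bar R}).
Variable L : set ((1 + m).-tuple R).
Local Notation tau := (tuple_product mu nu).
Local Notation hat t := (cintegral mu (wave t)).
Local Notation b := ((2 * pi)^-1 : R).
Local Notation M := (sqn mu (wave 0)).
Local Notation nu1 := (fine (nu setT)).

Hypotheses (N0 : (0 < N)%N) (uS : uniq S).
Hypothesis hat_zeros : forall t, t != 0 -> hat t = 0 -> cis (t * N%:R) = 1.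
Hypothesis hat_S : {in S &, forall s s', hat ((s%:R - s'%:R) / N%:R) != 0}.
Hypothesis size_S : (size S)%:R * hat 0 = N%:R.
Hypothesis window_wave : forall s t,
  L2inner mu (window b s) (wave t) = wave_integral 0 b (s - t).
Hypothesis window_sqn : forall s, sqn mu (window b s) = b.
Hypothesis nuT : nu setT != 0%E.
Hypothesis specL : is_spectrum tau L.

Let mu_fin : fin_num_fun mu := fin_num_measure mu.
Let nu_fin : fin_num_fun nu := fin_num_measure nu.

Local Notation freq x := (thead x : R).
Local Notation tail x := ([tuple of behead (x : (1 + m).-tuple R)] : m.-tuple R).
Let inS (z : int) := z \in map Posz S.
(** N t is split into integer part [fl] and fractional part [fr]; the latter labels the class of t
    modulo (1/N)Z, the former the position within the class. *)
Let fl (x : (1 + m).-tuple R) : int := Num.floor (N%:R * freq x).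
Let fr (x : (1 + m).-tuple R) : R := N%:R * freq x - (fl x)%:~R.
Let phi (v : R) : R := normc (wave_integral 0 b (v / N%:R)) ^+ 2.

Let N0' : N%:R != 0 :> R. Proof. by rewrite pnatr_eq0 -lt0n. Qed.

Let nu1_gt0 : 0 < nu1.
Proof.
rewrite fine_gt0 // lt0e nuT measure_ge0 /=.
by have := nu_fin measurableT; rewrite ge0_fin_numE.
Qed.

Let hat0 : hat 0 = M%:C.
Proof. by rewrite sqn_wave. Qed.

Let size_S_real : (size S)%:R * M = N%:R.
Proof.
apply: complexI; rewrite rmorphM /= -hat0.
by rewrite !rmorph_nat.
Qed.

Let M_gt0 : 0 < M.
Proof.
rewrite lt0r sqn_ge0 andbT; apply/eqP => h; move: size_S_real.
by rewrite h mulr0 => /esym/eqP; rewrite (negbTE N0').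
Qed.

Let sqn_mu_wave t : sqn mu (wave t) = M.
Proof. by apply: complexI; rewrite !sqn_wave. Qed.

Let b_gt0 : 0 < b. Proof. by rewrite invr_gt0 mulr_gt0 // pi_gt0. Qed.

Let b_le1 : b <= 1.
Proof. by rewrite invf_le1 ?mulr_gt0 ?pi_gt0 //; have := pi_ge2 R; lra. Qed.

Let inL2_expo_tau x : inL2 tau (expo x).
Proof.
rewrite expo_tensor; apply: inL2_tensor; first exact: inL2_wave.
exact: inL2_expo.
Qed.

Let sqn_expo_tau x : sqn tau (expo x) = M * nu1.
Proof.
rewrite expo_tensor sqn_tensor ?sqn_mu_wave ?sqn_expo //; first exact: inL2_wave.
exact: inL2_expo.
Qed.

(** The inner product in L^2(mu x nu) factors, so one of the two factors vanishes. *)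
Lemma spectrum_orth x x' : L x -> L x' -> x != x' ->
  hat (freq x - freq x') != 0 -> L2inner nu (expo (tail x)) (expo (tail x')) = 0.
Proof.
move=> Lx Lx' xx' h; have [_ [_ orth _]] := specL.
have := orth _ _ Lx Lx' xx'; rewrite !expo_tensor L2inner_tensor; first last.
- exact: inL2_expo.
- exact: inL2_wave.
- exact: inL2_expo.
- exact: inL2_wave.
by rewrite L2inner_wave => /eqP; rewrite mulf_eq0 (negbTE h) => /eqP.
Qed.

Lemma freqE x : freq x = (fr x + (fl x)%:~R) / N%:R.
Proof. by rewrite /fr subrK mulrC mulKf. Qed.

Lemma fr_ge0_lt1 x : 0 <= fr x < 1.
Proof.
have := floor_itv (N%:R * freq x); rewrite -/(fl x) intrD /fr.
by move=> /andP[h1 h2]; apply/andP; split; lra.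
Qed.

(* Frequencies in different classes modulo 1/N are never at distance a zero of
   the transform of [mu]; within one class [hat_S] applies. *)
Lemma shifted_orth (k : R -> int) x x' :
  L x -> L x' -> inS (fl x - k (fr x)) -> inS (fl x' - k (fr x')) -> x != x' ->
  L2inner nu (expo (tail x)) (expo (tail x')) = 0.
Proof.
move=> Lx Lx' /mapP[s sS es] /mapP[s' s'S es'] xx'; apply: spectrum_orth => //.
have [frE|frN] := eqVneq (fr x) (fr x').
  have -> : freq x - freq x' = (s%:R - s'%:R) / N%:R; last exact: hat_S.
  have e : fl x - fl x' = Posz s - Posz s' by rewrite -es -es' frE opprB addrA subrK.
  rewrite !freqE frE -mulrBl opprD addrACA subrr add0r -intrB e intrB.
  by [].
(* [hat_zeros] needs a nonzero argument; equal frequencies would have equal fractional parts. *)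
apply/eqP => h; have [e|tt'] := eqVneq (freq x) (freq x').
  by move: frN; rewrite /fr /fl e eqxx.
have := hat_zeros _ h; rewrite subr_eq0 => /(_ tt') /cis_eq1.
set j := Num.floor _; rewrite mulrBl ![_ * N%:R]mulrC => e.
have e1 : N%:R * freq x = N%:R * freq x' + j%:~R by lra.
move: frN; rewrite /fr /fl e1 floorDrz ?intr_int // intrKfloor intrD.
by rewrite opprD addrACA subrr addr0 eqxx.
Qed.

(** The bound is uniform in the shift [k], as [averaging] requires. Indexing by points [x] rather
    than by their tails spares an injectivity argument. *)
Lemma shifted_bessel (k : R -> int) (F : seq ((1 + m).-tuple R)) g :
  inL2 nu g -> uniq F -> {in F, forall x, L x} ->
  \sum_(x <- F | inS (fl x - k (fr x))) normc (L2inner nu g (expo (tail x))) ^+ 2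
    <= nu1 * sqn nu g.
Proof.
move=> Lg uF FL; rewrite -big_filter.
have := @bessel _ _ _ nu _ [seq x <- F | inS (fl x - k (fr x))]
  (fun x => expo (tail x)) g nu1.
apply => //.
- exact: filter_uniq.
- by move=> x _; exact: inL2_expo.
- by move=> x _; exact: sqn_expo.
- move=> x x'; rewrite !mem_filter => /andP[h /FL Lx] /andP[h' /FL Lx'].
  exact: shifted_orth Lx Lx' h h'.
Qed.

(** The coefficients of the tensor of a window with [g] factor, and modulating the window by s/N
    turns [fl x] into fl x - s in the argument of [phi]. *)
Lemma window_parseval g (eps : R) (s : nat) : inL2 nu g -> 0 < eps ->
  exists F : seq ((1 + m).-tuple R), [/\ uniq F, {in F, forall x, L x} &
    M * nu1 * (b * sqn nu g - eps) <=
    \sum_(x <- F) phi (fr x + (fl x - Posz s)%:~R) *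
       normc (L2inner nu g (expo (tail x))) ^+ 2].
Proof.
move=> Lg e0; have [_ [norm orth dense]] := specL.
have Lw := inL2_window b (s%:R / N%:R) mu_fin.
have LT := inL2_tensor Lw Lg.
have [F0 [c [FL0 happ]]] := dense _ LT _ e0.
have [c' ec] := sum_undup F0 (fun x => expo x) c.
exists (undup F0); split; first exact: undup_uniq.
  by move=> x; rewrite mem_undup; exact: FL0.
have FL x : x \in undup F0 -> L x by rewrite mem_undup; exact: FL0.
have Lapp : inL2 tau (fun v => tensor (window b (s%:R / N%:R)) g v -
    \sum_(i <- undup F0) c' i * expo i v).
  under eq_fun do rewrite -mulN1r; apply: inL2D => //; apply: inL2Z.
  by apply: inL2_sum => j _; apply: inL2Z.
move: happ; under [X in L2sqnorm _ X]eq_fun do rewrite ec.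
rewrite (L2sqnormE Lapp) lte_fin => /ltW happ.
have := @near_parseval _ _ _ tau _ (undup F0) (fun x => expo x) c' _ (M * nu1) eps LT
  (undup_uniq _) _ _ _ _ happ.
rewrite sqn_tensor // window_sqn => /(_ _ _ _ _)/le_trans; apply.
- by move=> x _.
- by move=> x _.
- by rewrite mulr_gt0.
- by move=> x x' /FL Lx /FL Lx'; exact: orth.
rewrite le_eqVlt; apply/orP; left; apply/eqP; apply: eq_bigr => x _.
rewrite expo_tensor L2inner_tensor //; [|exact: inL2_wave|exact: inL2_expo].
rewrite normcM exprMn window_wave; congr (_ * _).
(* The two arguments differ by a sign, which conjugates the integral and preserves its modulus. *)
rewrite /phi (_ : s%:R / N%:R - _ = - ((fr x + (fl x - Posz s)%:~R) / N%:R)).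
  by rewrite wave_integral_conj normc_conj.
by rewrite freqE intrB; field.
Qed.

(** One finite set serves all [s], since enlarging it only increases sums of nonnegative terms. *)
Lemma window_parseval_all g (eps : R) (S' : seq nat) : inL2 nu g -> 0 < eps ->
  exists F : seq ((1 + m).-tuple R), [/\ uniq F, {in F, forall x, L x} &
    {in S', forall s, M * nu1 * (b * sqn nu g - eps) <=
    \sum_(x <- F) phi (fr x + (fl x - Posz s)%:~R) *
       normc (L2inner nu g (expo (tail x))) ^+ 2}].
Proof.
move=> Lg e0; elim: S' => [|s S' [F [uF FL h]]]; first by exists [::]; split.
have [F' [uF' FL' h']] := window_parseval s Lg e0.
have w0 (z : nat) x : 0 <= phi (fr x + (fl x - Posz z)%:~R) *
    normc (L2inner nu g (expo (tail x))) ^+ 2 by rewrite mulr_ge0 ?sqr_ge0.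
exists (undup (F ++ F')); split; first exact: undup_uniq.
  by move=> x; rewrite mem_undup mem_cat => /orP[/FL|/FL'].
move=> z; rewrite inE => /orP[/eqP->|zS'].
  apply: (le_trans h'); apply: sum_subseq_le => //; first exact: undup_uniq.
  by move=> x xF; rewrite mem_undup mem_cat xF orbT.
apply: (le_trans (h z zS')); apply: sum_subseq_le => //; first exact: undup_uniq.
by move=> x xF; rewrite mem_undup mem_cat xF.
Qed.

(** Apply [averaging] with W = nu1 |g|^2 from Bessel in L^2(nu) and B = N b from Bessel on [0, N].
    The lower bound from [window_parseval_all] has the same leading term B W, which forces the
    unshifted sum to come close to W. *)
Lemma selected_parseval g (eps : R) : inL2 nu g -> 0 < eps ->
  exists F : seq ((1 + m).-tuple R), [/\ uniq F, {in F, forall x, L x} &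
    nu1 * (sqn nu g - eps) <=
    \sum_(x <- F | inS (fl x)) normc (L2inner nu g (expo (tail x))) ^+ 2].
Proof.
move=> Lg e0; pose c := (b * cos 1) ^+ 2 : R.
have c0 : 0 < c by rewrite exprn_gt0 // mulr_gt0 // cos1_gt0.
have N0R : 0 < N%:R :> R by rewrite ltr0n.
(* Summed over [S] with |S| M = N, this tolerance becomes c nu1 eps; dividing by [c] leaves nu1
   eps. *)
have d0 : 0 < c * eps / N%:R by rewrite divr_gt0 // mulr_gt0.
have [F [uF FL h]] := window_parseval_all S Lg d0.
exists F; split=> //.
pose w (x : (1 + m).-tuple R) := normc (L2inner nu g (expo (tail x))) ^+ 2.
have phi_bound v (K : seq int) : uniq K -> \sum_(k <- K) phi (v + k%:~R) <= N%:R * b.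
  move=> uK; rewrite -(big_map (fun k : int => (v + k%:~R) / N%:R) xpredT
    (fun t => normc (wave_integral 0 b t) ^+ 2)).
  apply: bessel_window => //.
  - by rewrite ltW //= (le_trans b_le1) // ler1n.
  - rewrite map_inj_uniq // => k k' /(mulIf (invr_neq0 N0'))/addrI.
    exact: intr_inj.
  - move=> t t' /mapP[k _ ->] /mapP[k' _ ->].
    rewrite -mulrBl mulfVK // opprD addrACA subrr add0r -intrB.
    exact: cis_int.
have phi_lower x : c <= phi (fr x).
  apply: wave_integral_lower; have /andP[f0 f1] := fr_ge0_lt1 x.
  rewrite divr_ge0 ?ler0n //= ler_pdivrMr // mul1r.
  by apply: (le_trans (ltW f1)); rewrite ler1n.
have cB : 0 <= c <= N%:R * b.
  (* A single term of the sum bounded by N b is already at least [c]; the zero tuple is an arbitrary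
     sample point. *)
  rewrite ltW //=; have := phi_bound (fr [tuple of nseq (1 + m) 0]) [:: 0] isT.
  by rewrite big_seq1 addr0; apply: le_trans; exact: phi_lower.
have := @averaging R _ F S w fl fr phi (nu1 * sqn nu g) (N%:R * b) c
  (fun x => sqr_ge0 _) (fun v => sqr_ge0 _) uS cB
  (fun k => shifted_bessel k Lg uF FL) phi_bound phi_lower.
move=> av.
have low : (size S)%:R * (M * nu1 * (b * sqn nu g - c * eps / N%:R)) <=
    \sum_(s <- S) \sum_(x <- F) phi (fr x + (fl x - Posz s)%:~R) * w x.
  rewrite -[X in X * _](_ : \sum_(s <- S) 1 = _); last first.
    by rewrite big_const_seq count_predT iter_addr_0.
  rewrite mulr_suml big_seq [leRHS]big_seq; apply: ler_sum => s sS.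
  by rewrite mul1r; exact: h.
have := le_trans low av.
rewrite !mulrA size_S_real mulrBr.
have -> : N%:R * nu1 * (c * eps / N%:R) = c * (nu1 * eps) by field.
move=> fin; rewrite -(ler_pM2l c0) mulrBr mulrBr.
by move: fin; rewrite !mulrA; lra.
Qed.

Lemma spectrum_of_selected :
  is_spectrum nu [set l | exists x, [/\ L x, inS (fl x) & l = tail x]].
Proof.
have [cL _] := specL; split.
  apply: sub_countable cL; apply: (@card_le_trans _ _ _ [set tail x | x in L]);
    last exact: card_image_le.
  by apply: subset_card_le => l [x [Lx _ ->]]; exists x.
split.
- move=> l _; split; first exact: inL2_expo.
  rewrite L2sqnormE; last exact: inL2_expo.
  by rewrite sqn_expo eqe gt_eqF.
- move=> l l' [x [Lx xS ->]] [x' [Lx' x'S ->]] ll'.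
  apply: (@shifted_orth (fun=> 0)) => //; rewrite ?subr0 //.
  by apply: contra ll' => /eqP->.
(* Half of [eps] turns the weak inequality of [selected_parseval] into a strict one. *)
- move=> g Lg eps e0; have e2 : 0 < eps / 2 by lra.
  have [F [uF FL h]] := selected_parseval Lg e2.
  pose F' := [seq x <- F | inS (fl x)].
  pose c l := L2inner nu g (expo l) / nu1%:C.
  exists (map (fun x => tail x) F'), c; split.
    move=> l /mapP[x]; rewrite mem_filter => /andP[xS xF] ->.
    by exists x; split=> //; exact: FL.
  have Lapp : inL2 nu
      (fun y => g y - \sum_(l <- map (fun x => tail x) F') c l * expo l y).
    under eq_fun do rewrite -mulN1r; apply: inL2D => //; apply: inL2Z.
    by apply: inL2_sum => l _; apply: inL2Z; exact: inL2_expo.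
  rewrite (L2sqnormE Lapp) lte_fin.
  (* The sum over tails becomes a sum over points of [F'], which are distinct. *)
  under [X in sqn _ X]eq_fun do rewrite big_map.
  rewrite (@sqn_sub_sum _ _ _ nu _ F' (fun x => expo (tail x))
    (fun x => c (tail x)) g nu1) //.
  + rewrite [X in _ * X]big1 ?mulr0 ?add0r; last first.
      by move=> x _; rewrite /c subrr normc0 expr0n.
    move: h; rewrite -big_filter -/F' -ler_pdivlMl // => h.
    by rewrite [X in _ - X]mulrC; lra.
  + exact: filter_uniq.
  + by move=> x _; exact: inL2_expo.
  + by move=> x _; exact: sqn_expo.
  + by rewrite gt_eqF.
  + move=> x x'; rewrite !mem_filter => /andP[h1 /FL Lx] /andP[h2 /FL Lx'].
    by apply: (@shifted_orth (fun=> 0)) => //; rewrite ?subr0.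
Qed.

End Descent.

(** The descent works with a finite measure. Packing the same set function keeps its product with
    [nu] convertible to the one in the theorem. *)
Definition finite_plus_unit (R : realType) (A : set nat)
    (Afin : fin_num_fun (lebesgue_on_plus_unit R A)) :
    {finite_measure set (measurableTypeR R) -> \bar R} :=
  HB.pack (lebesgue_on_plus_unit R A : set _ -> \bar R)
    (Measure.class (lebesgue_on_plus_unit R A))
    (Measure_isFinite.Build _ _ _ (lebesgue_on_plus_unit R A) Afin).

Theorem theorem1p5 (R : realType) (N m : nat) (A B : set nat)
    (nu : {finite_measure set (m.-tuple R) -> \bar R}) :
  (0 < N)%N ->
  complementary_pair N A B ->
  nu [set: m.-tuple R] != 0%E ->
  spectral_measure (tuple_product (lebesgue_on_plus_unit R A) nu) ->
  spectral_measure nu.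
Proof.
move=> N0 AB nuT [_ [L specL]]; split; first exact: fin_num_measure.
have [S [uS size_S hat_S]] := nonvanishing_set R N0 AB.
have Ofin := plus_unit_lty R N0 AB.
have b0 : 0 < (2 * pi)^-1 :> R by rewrite invr_gt0 mulr_gt0 // pi_gt0.
have b1 : (2 * pi)^-1 <= 1 :> R.
  by rewrite invf_le1 ?mulr_gt0 ?pi_gt0 //; have := pi_ge2 R; lra.
(* The window [0, 1/(2 pi)] lies in [0, 1], hence in A + [0,1] because 0 is in [A]. *)
have sub := plus_unit_01 N0 AB b1.
exists [set l | exists x : (1 + m).-tuple R,
  [/\ L x, Num.floor (N%:R * thead x) \in map Posz S & l = [tuple of behead x]]].
apply: (@spectrum_of_selected R m N S
  (finite_plus_unit (@fin_num_plus_unit R N A B N0 AB)) nu L) => //.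
- by move=> t; exact: (transform_zeros N0 AB).
- by move=> s t; exact: (L2inner_window (measurable_plus_unit A)).
- by move=> s; apply: (sqn_window (measurable_plus_unit A)) => //; exact: ltW.
Qed.
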